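(* Let $D$ be a weighted oriented unmixed forest with underlying simple graph $G$. Let $\{\{x_1,y_1\},\ldots,\{x_r,y_r\}\}$ be a perfect matching of $G$ with $d_G(y_i)=1$ for all $i$, and suppose that $y_1,\ldots,y_r$ are sinks of $D$. Then $$\operatorname{reg}(I(D))=\max\Big\{\sum_{j=1}^{s}w(y_{i_j})+1\Big\},$$ where the maximum is taken over all nonempty families $\{x_{i_1},y_{i_1}\},\ldots,\{x_{i_s},y_{i_s}\}$ of distinct edges of the perfect matching no two of which are adjacent in $G$.
   Context: A weighted oriented graph $D=(V(D),E(D),w)$ consists of a finite simple graph $G$ (the underlying graph) on vertex set $V(D)=V(G)$, with each edge given one orientation, $(x,y)\in E(D)$ meaning an edge directed from $x$ to $y$, and a weight function $w:V(D)\to\{1,2,3,\ldots\}$. A vertex is a source if it has no incoming edges and a sink if it has no outgoing edges; by convention $w(x)=1$ whenever $x$ is a source. $D$ is a forest if $G$ is a forest. Let $R$ be the polynomial ring over a field $\mathbb{K}$ whose variables are the vertices of $D$. The edge ideal is $I(D)=(x\,y^{w(y)} : (x,y)\in E(D))\subset R$. $D$ is unmixed if all associated primes of $I(D)$ have the same height. $d_G(v)$ is the degree of $v$ in $G$. Two distinct edges $\{x,y\},\{z,u\}$ of $G$ are adjacent if there is an edge $\{a,b\}$ of $G$ with $a\in\{x,y\}$ and $b\in\{z,u\}$. For a homogeneous ideal $I$, $\operatorname{reg}(I)=\max\{j-i : \beta_{i,j}(I)\ne 0\}$ is its Castelnuovo–Mumford regularity. *)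

(* Defs.v *)
From mathcomp Require Import all_boot all_order all_algebra.
From mathcomp.multinomials Require Import mpoly.

Set Implicit Arguments.
Unset Strict Implicit.
Unset Printing Implicit Defensive.

Import GRing.Theory.
Local Open Scope ring_scope.

(* Ideals are Prop-valued predicates, compared pointwise. *)
Section Ideals.
Variable R : comNzRingType.
Implicit Types I P : R -> Prop.

Definition is_ideal I : Prop :=
  [/\ I 0, forall a b, I a -> I b -> I (a + b) & forall a b, I b -> I (a * b)].

Definition is_prime P : Prop :=
  [/\ is_ideal P, ~ P 1 & forall a b, P (a * b) -> P a \/ P b].

(* Associated primes of the quotient R / I: the primes of the form (I : f). *)
Definition associated_prime I P : Prop :=
  is_prime P /\ exists f : R, forall g : R, P g <-> I (g * f).

Definition ideal_lt I P : Prop :=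
  (forall g, I g -> P g) /\ exists g, P g /\ ~ I g.

(* c 0 < c 1 < ... < c h = P; only the first h + 1 terms of c matter. *)
Definition prime_chain (h : nat) P (c : nat -> R -> Prop) : Prop :=
  [/\ forall i, (i <= h)%N -> is_prime (c i),
      forall i, (i < h)%N -> ideal_lt (c i) (c i.+1)
    & forall g, c h g <-> P g].

Definition has_height P (h : nat) : Prop :=
  (exists c, prime_chain h P c)
  /\ (forall k c, prime_chain k P c -> (k <= h)%N).

Definition unmixed_ideal I : Prop :=
  exists h : nat, forall P, associated_prime I P -> has_height P h.

End Ideals.

Section Regularity.
Variables (K : fieldType) (n : nat).
Local Notation R := {mpoly K[n]}.

(* A graded complex ... -> F_1 -> F_0 -> R, where F_i is the free module of
   row vectors 'rV[R]_(rk i), its a-th basis vector having degree gdeg a, and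
   where maps act by right multiplication. *)
Record free_complex := FreeComplex {
  rk : nat -> nat;
  gdeg : forall i, 'I_(rk i) -> nat;
  aug : 'cV[R]_(rk 0);
  diff : forall i, 'M[R]_(rk i.+1, rk i) }.

(* p is zero or homogeneous with deg p + d = e, i.e. multiplication by p is a
   degree 0 map R(-e) -> R(-d); in particular p = 0 if e < d. *)
Definition graded_entry (e d : nat) (p : R) : Prop :=
  forall m, m \in msupp p -> (mdeg m + d)%N = e.

Definition graded_complex (F : free_complex) : Prop :=
  (forall a, graded_entry (gdeg a) 0 (aug F a 0))
  /\ (forall i a b, graded_entry (gdeg a) (gdeg b) (diff F i a b)).

Definition resolves (F : free_complex) (I : R -> Prop) : Prop :=
  [/\ forall p, I p <-> exists u : 'rV[R]_(rk F 0), (u *m aug F) 0 0 = p,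
      forall u : 'rV[R]_(rk F 0),
        u *m aug F = 0 <-> exists v, u = v *m diff F 0
    & forall i (u : 'rV[R]_(rk F i.+1)),
        u *m diff F i = 0 <-> exists v, u = v *m diff F i.+1].

(* All entries of the differentials lie in the ideal of the variables. *)
Definition minimal_complex (F : free_complex) : Prop :=
  forall i a b, (diff F i a b)@_0%MM = 0.

Definition minimal_graded_resolution (F : free_complex) (I : R -> Prop) : Prop :=
  [/\ graded_complex F, resolves F I & minimal_complex F].

(* b is the table of graded Betti numbers of I; a minimal graded free
   resolution is unique up to isomorphism, so at most one b qualifies. *)
Definition graded_betti (I : R -> Prop) (b : nat -> nat -> nat) : Prop :=
  exists F, minimal_graded_resolution F I
    /\ forall i j, b i j = #|[set a : 'I_(rk F i) | gdeg a == j]|.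

Definition has_regularity (I : R -> Prop) (m : int) : Prop :=
  exists b, [/\ graded_betti I b,
    exists i j, b i j <> 0%N /\ m = j%:Z - i%:Z
  & forall i j, b i j <> 0%N -> j%:Z - i%:Z <= m].

End Regularity.

Record woGraph (V : finType) := WOGraph {
  arc : rel V;
  weight : V -> nat;
  (* no loops, and each edge carries exactly one orientation *)
  arc_asym : forall x y, arc x y -> ~~ arc y x;
  weight_gt0 : forall x, (0 < weight x)%N;
  weight_source : forall x, (forall z, ~~ arc z x) -> weight x = 1%N }.

Section Graphs.
Variables (V : finType) (D : woGraph V).

Definition edge : rel V := fun x y => arc D x y || arc D y x.

Definition is_sink (x : V) : Prop := forall z, ~~ arc D x z.

Definition degree (x : V) : nat := #|[set z | edge x z]|.

Definition is_forest : Prop :=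
  forall c : seq V, (2 < size c)%N -> ~ ucycle edge c.

Definition adjacent_edges (e f : {set V}) : bool :=
  [exists a in e, exists b in f, edge a b].

Definition perfect_matching (r : nat) (x y : 'I_r -> V) : Prop :=
  (forall i, edge (x i) (y i))
  /\ (forall v, exists! i, v \in [set x i; y i]).

Variable K : fieldType.

Definition vertex_var (v : V) : {mpoly K[#|V|]} := 'X_(enum_rank v).

Definition edge_ideal (p : {mpoly K[#|V|]}) : Prop :=
  exists c : V * V -> {mpoly K[#|V|]},
    p = \sum_(e : V * V | arc D e.1 e.2)
          c e * (vertex_var e.1 * vertex_var e.2 ^+ weight D e.2).

End Graphs.

Arguments edge_ideal {V} D K p.

(* Sets of indices of pairwise non-adjacent edges {x_i, y_i}. *)
Definition nonadjacent_family (V : finType) (D : woGraph V) (r : nat)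
    (x y : 'I_r -> V) (A : {set 'I_r}) : bool :=
  [forall i in A, forall j in A,
     (i != j) ==> ~~ adjacent_edges D [set x i; y i] [set x j; y j]].

(* Main.v *)
(* Unmixedness forces every x_i to have weight 1: otherwise two associated
   primes generated by variables would be strictly nested. Hence I(D) is
   generated by the x_i x_j, for the edges of the forest H induced on the x_i,
   and by the x_i y_i^(w_i).

   If I is a monomial ideal and m a monomial, the mapping cone of a comparison
   map from a resolution of R/(I : m), twisted by m, to one of R/I resolves
   R/(I + (m)); it is minimal as soon as m involves a variable which does not
   occur in the multidegrees of the resolution of R/I. Let i be a leaf of H with
   neighbour k, and J the ideal of H - i. Adding x_i x_k and then x_i y_i^(w_i)
   to J, the colon ideals are J : x_k, which is generated by y_k^(w_k), by the
   neighbours of x_k and by the ideal of H - N[k], and J + (x_k), which is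
   generated by x_k and by the ideal of H - {i, k}. Both cones are minimal, so
   reg R/I(H) = max(reg R/I(H - i), reg R/I(H - {i, k}) + w_i), which is the
   recursion satisfied by the weighted independence number of H. *)
Require Import Defs.
From mathcomp Require Import all_boot all_order all_algebra.
From mathcomp.multinomials Require Import mpoly.
From mathcomp Require Import zify.

Set Implicit Arguments.
Unset Strict Implicit.
Unset Printing Implicit Defensive.

Import GRing.Theory.
Local Open Scope ring_scope.

(** * Multigraded resolutions and mapping cones *)

Section Support.
Variables (K : fieldType).

Definition supported N (P : pred 'I_N) (u : 'rV[K]_N) : Prop :=
  forall a, u 0 a != 0 -> P a.

Lemma supported0 N (P : pred 'I_N) : supported P 0.
Proof. by move=> a; rewrite mxE eqxx. Qed.

Lemma supportedD N (P : pred 'I_N) u v :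
  supported P u -> supported P v -> supported P (u + v).
Proof.
move=> hu hv a; rewrite mxE => h.
have [u0|/hu//] := eqVneq (u 0 a) 0.
by apply: hv; move: h; rewrite u0 add0r.
Qed.

Lemma supportedZ N (P : pred 'I_N) c u :
  supported P u -> supported P (c *: u).
Proof. by move=> hu a; rewrite mxE mulf_eq0 negb_or => /andP[_ /hu]. Qed.

Lemma supportedN N (P : pred 'I_N) u : supported P u -> supported P (- u).
Proof. by rewrite -scaleN1r; apply: supportedZ. Qed.

Lemma delta_mx_neq0 N N' (i a : 'I_N) (j b : 'I_N') :
  (delta_mx i j a b : K) != 0 -> a = i /\ b = j.
Proof.
rewrite mxE; case: (eqVneq a i) => [->|_]; last by rewrite eqxx.
by case: (eqVneq b j) => [->|_]; rewrite ?eqxx.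
Qed.

Lemma supported_delta N (P : pred 'I_N) a : P a -> supported P (delta_mx 0 a).
Proof.
by move=> Pa b /delta_mx_neq0[_ ->].
Qed.

Lemma supported_mulmx N N' (P : pred 'I_N) (Q : pred 'I_N') u (M : 'M_(N, N')) :
    supported P u -> (forall a b, P a -> M a b != 0 -> Q b) ->
  supported Q (u *m M).
Proof.
move=> hu hM b; rewrite mxE => h.
have [a ha] : exists a, u 0 a * M a b != 0.
  apply/existsP; apply: contraNT h => /existsPn h0.
  by rewrite big1 // => a _; apply/eqP; have := h0 a; rewrite negbK.
by move: ha; rewrite mulf_eq0 negb_or => /andP[/hu Pa /hM]; apply.
Qed.

Lemma supported_row_mx N N' (P : pred 'I_(N + N')) u v :
    supported (fun a => P (lshift N' a)) u ->
    supported (fun a => P (rshift N a)) v ->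
  supported P (row_mx u v).
Proof.
by move=> hu hv a; case: (split_ordP a) => b ->;
   rewrite ?row_mxEl ?row_mxEr; [apply: hu|apply: hv].
Qed.

End Support.

Section Complexes.
Variables (K : fieldType) (n : nat).
Implicit Types (I J : 'X_{1..n} -> Prop) (m : 'X_{1..n}).

(* A bounded multigraded complex of finite free modules, with all homological
   degrees collected in one module: the basis vector a has homological degree
   hdg a and multidegree mdg a, and a is mapped to the sum over b of
   dif a b * X^(mdg a - mdg b) * b. *)
Record mcomplex := MComplex {
  size_of : nat;
  hdg : 'I_size_of -> nat;
  mdg : 'I_size_of -> 'X_{1..n};
  dif : 'M[K]_size_of;
  base : 'I_size_of }.

(** The strand of multidegree [m] is the [K]-space on the vectors [X^(m - mdg a) * a] with [a] in
    [below m]. The differential acts on it by the scalar matrix [dif], so exactness is linear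
    algebra over [K] in each strand. *)
Definition below (C : mcomplex) m : pred 'I_(size_of C) :=
  fun a => (mdg a <= m)%MM.

(* C minimally resolves R / I, where I is the set of monomials of a monomial
   ideal; base C generates the free module in homological degree 0. *)
Record resolution (C : mcomplex) I : Prop := Resolution {
  hdg_eq0 : forall a, (hdg a == 0%N) = (a == base C);
  mdg_base : mdg (base C) = 0%MM;
  dif_hdg : forall a b, dif C a b != 0 -> hdg a = (hdg b).+1;
  dif_mdg : forall a b, dif C a b != 0 -> (mdg b <= mdg a)%MM;
  dif_min : forall a b, dif C a b != 0 -> mdg b != mdg a;
  dif_sq : dif C *m dif C = 0;
  dif_exact : forall m u, supported (below m) u -> u *m dif C = 0 ->
    u 0 (base C) = 0 -> exists2 v, supported (below m) v & v *m dif C = u;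
  dif_base : forall m, (exists2 v, supported (below m) v &
    v *m dif C = delta_mx 0 (base C)) <-> I m }.

Definition hproj (C : mcomplex) k (u : 'rV[K]_(size_of C)) :=
  \row_a (if hdg a == k then u 0 a else 0).

Section Theory.
Variables (C : mcomplex) (I : 'X_{1..n} -> Prop) (CI : resolution C I).

Lemma hproj_dif k (u : 'rV[K]_(size_of C)) :
  hproj k (u *m dif C) = hproj k.+1 u *m dif C.
Proof.
apply/rowP=> b; rewrite !mxE; case: eqP => hb; last first.
  rewrite big1 // => a _; rewrite mxE; case: eqP => ha; last by rewrite mul0r.
  have [->|/(dif_hdg CI)] := eqVneq (dif C a b) 0; first by rewrite mulr0.
  by rewrite ha => -[/esym].
apply: eq_bigr => a _; rewrite mxE; case: eqP => // ha.
have [->|/(dif_hdg CI)] := eqVneq (dif C a b) 0; first by rewrite !mulr0.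
by rewrite hb.
Qed.

Lemma supported_hproj k (P : pred 'I_(size_of C)) u :
  supported P u -> supported (fun a => P a && (hdg a == k)) (hproj k u).
Proof.
by move=> hu a; rewrite mxE; case: (hdg a =P k) => [_ /hu->|_] //; rewrite eqxx.
Qed.

Lemma hproj_id k (u : 'rV[K]_(size_of C)) :
  supported (fun a => hdg a == k) u -> hproj k u = u.
Proof.
move=> hu; apply/rowP=> a; rewrite mxE; case: ifP => // /negP ha.
by apply/esym/eqP; apply/negPn/negP => /hu.
Qed.

Lemma row_dif_base : (delta_mx 0 (base C) : 'rV_(size_of C)) *m dif C = 0.
Proof.
rewrite -rowE; apply/rowP=> b; rewrite !mxE; apply/eqP/negPn/negP.
by move=> /(dif_hdg CI); have := hdg_eq0 CI (base C); rewrite eqxx => /eqP->.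
Qed.

Lemma supported_base (u : 'rV[K]_(size_of C)) :
  supported (fun a => hdg a == 0%N) u ->
    u = u 0 (base C) *: delta_mx 0 (base C).
Proof.
move=> hu; apply/rowP=> a; rewrite !mxE eqxx /=.
case: eqVneq => [->|na]; first by rewrite mulr1.
rewrite mulr0; apply/eqP/negPn/negP => /hu.
by rewrite (hdg_eq0 CI) (negPf na).
Qed.

Lemma below_base m : below m (base C).
Proof. by rewrite /below (mdg_base CI); apply/mnm_lepP=> i; rewrite mnm0E. Qed.

(** For [m] in [I] the vector [base C] is itself a boundary in the strand of [m]; subtracting its
    multiple from [u] reduces to [dif_exact]. *)
Lemma cycle_boundary m u : supported (@below C m) u -> u *m dif C = 0 -> I m ->
  exists2 v, supported (@below C m) v & v *m dif C = u.
Proof.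
move=> hu u0 /(dif_base CI)[b hb db].
have [|||v hv dv] := dif_exact CI (m := m)
    (u := u - u 0 (base C) *: delta_mx 0 (base C)).
- apply: supportedD => //; apply/supportedN/supportedZ/supported_delta.
  exact: below_base.
- by rewrite mulmxBl u0 -scalemxAl row_dif_base scaler0 subr0.
- by rewrite !mxE !eqxx mulr1 subrr.
exists (v + u 0 (base C) *: b); last first.
  by rewrite mulmxDl dv -scalemxAl db subrK.
by apply: supportedD => //; apply: supportedZ.
Qed.

(** The part of [u] in homological degree 1 already maps to [c] times the base vector, and [c] is
    invertible. *)
Lemma base_boundary m u c : c != 0 -> supported (@below C m) u ->
  (u *m dif C) 0 (base C) = c -> I m.
Proof.
move=> c0 hu uc; apply/(dif_base CI).
exists (c^-1 *: hproj 1 u).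
  by apply: supportedZ => a /(supported_hproj hu)/andP[].
rewrite -scalemxAl -hproj_dif [hproj 0 _]supported_base; last first.
  by move=> a /(@supported_hproj 0 predT); apply=> b.
by rewrite mxE (hdg_eq0 CI) eqxx uc scalerA mulVf // scale1r.
Qed.

(** The lifting step for comparison maps. In homological degree 0 a cycle involving [base C] bounds
    only when [m] lies in [I], whence the last hypothesis. *)
Lemma homogeneous_boundary m k u : supported (@below C m) u ->
    supported (fun a => hdg a == k) u -> u *m dif C = 0 ->
    ((0 < k)%N \/ (u 0 (base C) != 0 -> I m)) ->
  exists v, supported (fun a => below m a && (hdg a == k.+1)) v
    /\ v *m dif C = u.
Proof.
move=> hu ku u0 hk.
have [v hv dv] : exists2 v, supported (@below C m) v & v *m dif C = u.
  have [ub|nub] := eqVneq (u 0 (base C)) 0; first exact: (dif_exact CI).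
  apply: cycle_boundary => //; case: hk => [k0|]; last by apply.
  by have := ku _ nub; have := hdg_eq0 CI (base C); rewrite eqxx; lia.
exists (hproj k.+1 v); split; first exact: supported_hproj.
by rewrite -hproj_dif dv hproj_id.
Qed.

End Theory.

(** * Comparison maps and the mapping cone *)

Section Cone.
Variables (F G : mcomplex) (I : 'X_{1..n} -> Prop) (m0 : 'X_{1..n}).
Variables (FI : resolution F I) (GI : resolution G (fun m => I (m + m0)%MM)).

(** Multiplication by [X^m0] maps [R/(I : X^m0)] to [R/I]; it is lifted to the resolutions by
    induction on the homological degree, which is bounded. *)
Lemma comparison_map : exists phi : 'M[K]_(size_of G, size_of F),
  [/\ row (base G) phi = delta_mx 0 (base F),
      forall a b, phi a b != 0 -> hdg a = hdg b,
      forall a b, phi a b != 0 -> (mdg b <= mdg a + m0)%MM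
    & dif G *m phi = phi *m dif F].
Proof.
pose good k (phi : 'M[K]_(size_of G, size_of F)) :=
  [/\ row (base G) phi = delta_mx 0 (base F),
      forall a b, phi a b != 0 -> hdg a = hdg b,
      forall a b, phi a b != 0 -> (mdg b <= mdg a + m0)%MM
    & forall a, (hdg a <= k)%N -> row a (dif G *m phi) = row a (phi *m dif F)].
have step k : exists phi, good k phi.
  elim: k => [|k [phi [phi0 phih phim phid]]].
    exists (delta_mx (base G) (base F)); split.
    - by apply/rowP=> b; rewrite !mxE eqxx.
    - move=> a b /delta_mx_neq0[-> ->].
      have := hdg_eq0 FI (base F); have := hdg_eq0 GI (base G).
      by rewrite !eqxx => /eqP-> /eqP->.
    - by move=> a b /delta_mx_neq0[-> ->]; rewrite (mdg_base FI);
        apply/mnm_lepP=> i; rewrite mnm0E.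
    move=> a; rewrite leqn0 (hdg_eq0 GI) => /eqP->.
    rewrite !row_mul !rowE (row_dif_base GI) mul0mx.
    suff -> : delta_mx 0 (base G) *m delta_mx (base G) (base F)
      = delta_mx 0 (base F) :> 'M[K]_(1, _) by rewrite (row_dif_base FI).
    by rewrite mul_delta_mx.
  (* Rows of homological degree [k.+1] are replaced by lifts; all others are kept. *)
  have /fin_all_exists[psi hpsi] a : exists v : 'rV[K]_(size_of F),
      if hdg a == k.+1 then
        supported (fun b => below (mdg a + m0) b && (hdg b == k.+1)) v /\
        v *m dif F = row a (dif G *m phi)
      else v = row a phi.
    case: eqP => ha; last by exists (row a phi).
    have ra : supported (fun b => (hdg b == k) && (mdg b <= mdg a)%MM)
       (row a (dif G)).
      move=> b; rewrite mxE => ab; rewrite (dif_mdg GI) // andbT.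
      by move/(dif_hdg GI): ab; rewrite ha => -[->].
    rewrite row_mul.
    apply: (homogeneous_boundary FI).
    - apply: (supported_mulmx ra) => b c /andP[_ hb] /phim hc.
      apply: lepm_trans hc _; apply/mnm_lepP=> i; rewrite !mnmDE leq_add2r.
      by move/mnm_lepP: hb.
    - by apply: (supported_mulmx ra) => b c /andP[/eqP <- _] /phih->.
    - have <- : row a (dif G) *m (dif G *m phi) = row a (dif G) *m phi *m dif F.
        rewrite -mulmxA; apply/rowP=> c; rewrite !mxE; apply: eq_bigr => b _.
        rewrite mxE; have [->|ab] := eqVneq (dif G a b) 0.
          by rewrite !mul0r.
        congr (_ * _); have : (hdg b <= k)%N.
          by move/(dif_hdg GI): ab; rewrite ha => -[->].
        by move=> /phid/rowP/(_ c); rewrite !mxE.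
      by rewrite mulmxA -row_mul (dif_sq GI) row0 mul0mx.
    (* For [k = 0], a nonzero coefficient at [base F] means that [a] bounds a nonzero multiple of
       [base G], so [mdg a] lies in [I : X^m0]. *)
    - case: k ha ra phid => [|k] ha ra phid; last by left.
      right => nz.
      have er := supported_base GI (fun b hb => proj1 (andP (ra b hb))).
      apply: (base_boundary GI (u := delta_mx 0 a)
        (c := (delta_mx 0 a *m dif G) 0 (base G))) => //.
        apply: contraNneq nz; rewrite -rowE => z.
        by rewrite er z scale0r mul0mx mxE.
      by apply: supported_delta; apply: lepm_refl.
  exists (\matrix_(a, b) psi a 0 b).
  have rowpsi a : row a (\matrix_(a, b) psi a 0 b) = psi a.
    by apply/rowP=> b; rewrite !mxE.
  have psilow a : (hdg a <= k)%N -> psi a = row a phi.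
    by move=> ha; have := hpsi a; case: eqP => // eqa; rewrite eqa ltnn in ha.
  split.
  - rewrite rowpsi psilow // .
    by have := hdg_eq0 GI (base G); rewrite eqxx => /eqP->.
  - move=> a b; rewrite mxE; have := hpsi a; case: eqP => [ha [hs _] /hs|_ ->].
      by case/andP=> _ /eqP->.
    by rewrite mxE; apply: phih.
  - move=> a b; rewrite mxE; have := hpsi a; case: eqP => [ha [hs _] /hs|_ ->].
      by case/andP.
    by rewrite mxE; apply: phim.
  move=> a ha; rewrite !row_mul rowpsi.
  have -> : row a (dif G) *m (\matrix_(a, b) psi a 0 b) = row a (dif G) *m phi.
    apply/rowP=> c; rewrite !mxE; apply: eq_bigr => b _; rewrite !mxE.
    have [->|ab] := eqVneq (dif G a b) 0; first by rewrite !mul0r.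
    congr (_ * _); rewrite psilow ?mxE //.
    by move/(dif_hdg GI): ab ha => ->.
  have := hpsi a; case: eqP => [_ [_ ->]|na ->]; first by rewrite row_mul.
  by rewrite -!row_mul phid //; lia.
have [phi [phi0 phih phim phid]] := step (\max_a @hdg G a)%N.
exists phi; split=> //; apply/row_matrixP=> a; apply: phid.
exact: (leq_bigmax a).
Qed.

(** An entry of the comparison map between equal multidegrees would be a constant and could spoil
    the minimality of the cone. *)
Hypothesis min : forall (a : 'I_(size_of G)) (b : 'I_(size_of F)),
  mdg b != (mdg a + m0)%MM.

Definition cone (phi : 'M[K]_(size_of G, size_of F)) := MComplex
  (fun a => match split a with inl b => hdg b | inr c => (hdg c).+1 end)
  (fun a => match split a with inl b => mdg b | inr c => (mdg c + m0)%MM end)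
  (block_mx (dif F) 0 phi (- dif G)) (lshift _ (base F)).

(** Multiplication by [X^m0] from [R/(I : X^m0)] to [R/I] is injective with cokernel
    [R/(I + (X^m0))], which the cone therefore resolves; the proof checks this strand by strand. *)
Lemma cone_resolution : exists phi,
  resolution (cone phi) (fun m => I m \/ (m0 <= m)%MM).
Proof.
have [phi [phi0 phih phim phid]] := comparison_map; exists phi.
have hdgl a : @hdg (cone phi) (lshift _ a) = hdg a.
  by rewrite /= (unsplitK (inl a)).
have hdgr a : @hdg (cone phi) (rshift _ a) = (hdg a).+1.
  by rewrite /= (unsplitK (inr a)).
have mdgl a : @mdg (cone phi) (lshift _ a) = mdg a.
  by rewrite /= (unsplitK (inl a)).
have mdgr a : @mdg (cone phi) (rshift _ a) = (mdg a + m0)%MM.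
  by rewrite /= (unsplitK (inr a)).
have lem_add m m' : (m <= m' -> m + m0 <= m' + m0)%MM.
  move=> /mnm_lepP le_m; apply/mnm_lepP=> i.
  by rewrite !mnmDE leq_add2r.
have difP (P : 'I_(size_of (cone phi)) -> 'I_(size_of (cone phi)) -> Prop) :
    (forall a b, dif F a b != 0 -> P (lshift _ a) (lshift _ b)) ->
    (forall a b, phi a b != 0 -> P (rshift _ a) (lshift _ b)) ->
    (forall a b, dif G a b != 0 -> P (rshift _ a) (rshift _ b)) ->
    forall a b, dif (cone phi) a b != 0 -> P a b.
  move=> hF hphi hG a b; rewrite /dif /=.
  case: (split_ordP a) => a' ->; case: (split_ordP b) => b' ->.
  - by rewrite block_mxEul; apply: hF.
  - by rewrite block_mxEur mxE eqxx.
  - by rewrite block_mxEdl; apply: hphi.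
  - by rewrite block_mxEdr mxE oppr_eq0; apply: hG.
have belowl m (u : 'rV[K]_(size_of F)) : supported (@below F m) u ->
    supported (@below (cone phi) m) (row_mx u 0).
  move=> hu; apply: supported_row_mx; last exact: supported0.
  by move=> a /hu; rewrite /below mdgl.
split.
- move=> a; case: (split_ordP a) => b ->.
    by rewrite hdgl (hdg_eq0 FI) (inj_eq (@lshift_inj _ _)).
  by rewrite hdgr /= eq_rlshift.
- by rewrite mdgl (mdg_base FI).
- apply: difP => a b.
  + by rewrite !hdgl => /(dif_hdg FI).
  + by rewrite hdgl hdgr => /phih->.
  + by rewrite !hdgr => /(dif_hdg GI)->.
- apply: difP => a b.
  + by rewrite !mdgl => /(dif_mdg FI).
  + by rewrite mdgl mdgr => /phim.
  + by rewrite !mdgr => /(dif_mdg GI); apply: lem_add.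
- apply: difP => a b.
  + by rewrite !mdgl => /(dif_min FI).
  + by rewrite mdgl mdgr.
  + rewrite !mdgr => /(dif_min GI); apply: contraNneq.
    by move=> /(congr1 (fun m => m - m0)%MM); rewrite !addmK => ->.
- rewrite /dif /= mulmx_block (dif_sq FI) !mulNmx !mulmxN (dif_sq GI).
  by rewrite !mul0mx !mulmx0 !oppr0 !addr0 phid subrr block_mx0.
- move=> m; rewrite /= => u; rewrite -[u]hsubmxK.
  set u1 := lsubmx u; set u2 := rsubmx u => hu.
  have hu1 : supported (@below F m) u1.
    move=> a ha; have := hu (lshift _ a).
    by rewrite /below mdgl row_mxEl; apply.
  have hu2 a : u2 0 a != 0 -> (mdg a + m0 <= m)%MM.
    by move=> ha; have := hu (rshift _ a); rewrite /below mdgr row_mxEr; apply.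
  rewrite mul_row_block mulmx0 add0r mulmxN row_mxEl => du ub.
  have du1 : u1 *m dif F + u2 *m phi = 0.
    by have := congr1 lsubmx du; rewrite row_mxKl linear0.
  have du2 : u2 *m dif G = 0.
    have := congr1 rsubmx du; rewrite row_mxKr linear0 => /eqP.
    by rewrite oppr_eq0 => /eqP.
  (* If [m0] does not divide [m], the strand of [m] has no part from [G], and exactness is that of
     [F]. *)
  have [lem0|nlem0] := boolP (m0 <= m)%MM; last first.
    have u20 : u2 = 0.
      apply/rowP=> a; rewrite [RHS]mxE; apply/eqP/negPn/negP => /hu2 le_am.
      case/negP: nlem0; apply: lepm_trans le_am.
      by apply/mnm_lepP=> i; rewrite mnmDE leq_addl.
    move: du1; rewrite u20 mul0mx addr0 => du1.
    have [v hv dv] := dif_exact FI hu1 du1 ub.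
    exists (row_mx v 0); first exact: belowl.
    by rewrite mul_row_block !mul0mx mulmx0 !addr0 dv.
  have hu2' : supported (@below G (m - m0)) u2.
    move=> a /hu2/mnm_lepP le_a; apply/mnm_lepP=> i.
    by have := le_a i; rewrite mnmDE mnmBE; lia.
  (* The base coefficient of [v2] is removed so that [v2 *m phi] has none either, as exactness of
     [F] requires. *)
  have [v2 hv2 [dv2 v2b]] : exists2 v2, supported (@below G (m - m0)) v2 &
      v2 *m dif G = u2 /\ v2 0 (base G) = 0.
    suff [v hv dv] : exists2 v, supported (@below G (m - m0)) v &
        v *m dif G = u2.
      exists (v - v 0 (base G) *: delta_mx 0 (base G)).
        apply: supportedD => //; apply/supportedN/supportedZ/supported_delta.
        exact: (below_base GI).
      rewrite mulmxBl -scalemxAl (row_dif_base GI) scaler0 subr0 dv.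
      by rewrite !mxE !eqxx mulr1 subrr.
    (* If [u2] has a nonzero base coefficient, so has the boundary of [- u1] in [F]; hence [m] lies
       in [I], and every cycle of [G] in the strand of [m - m0] bounds. *)
    have [u2b|u2b] := eqVneq (u2 0 (base G)) 0; first exact: (dif_exact GI).
    apply: (cycle_boundary GI) => //; rewrite submK //.
    apply: (base_boundary FI (u := - u1) (c := u2 0 (base G))) => //.
      exact: supportedN.
    move/eqP: du1; rewrite addrC addr_eq0 mulNmx => /eqP <-.
    rewrite mxE (bigD1 (base G)) //= big1 ?addr0.
      have -> : phi (base G) (base F) = row (base G) phi 0 (base F).
        by rewrite mxE.
      by rewrite phi0 [delta_mx _ _ _ _]mxE !eqxx mulr1.
    move=> a na; have [->|/phih] := eqVneq (phi a (base F)) 0.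
      by rewrite mulr0.
    have := hdg_eq0 FI (base F); rewrite eqxx => /eqP-> /eqP.
    by rewrite (hdg_eq0 GI) (negPf na).
  have hv2phi : supported (@below F m) (v2 *m phi).
    apply: (supported_mulmx hv2) => a b ha /phim hb; apply: lepm_trans hb _.
    by rewrite -(submK lem0); apply: lem_add.
  have [||| v1 hv1 dv1] := dif_exact FI (m := m) (u := u1 + v2 *m phi).
  + exact: supportedD.
  + by rewrite mulmxDl -mulmxA -phid mulmxA dv2.
  + rewrite mxE ub add0r.
    rewrite mxE (bigD1 (base G)) //= v2b mul0r add0r big1 // => a na.
    have [->|/phih] := eqVneq (phi a (base F)) 0; first by rewrite mulr0.
    have := hdg_eq0 FI (base F); rewrite eqxx => /eqP-> /eqP.
    by rewrite (hdg_eq0 GI) (negPf na).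
  exists (row_mx v1 (- v2)).
    apply: supported_row_mx => a.
      by rewrite /below mdgl; apply: hv1.
    rewrite /below mdgr mxE oppr_eq0 => /hv2 le_a.
    by rewrite -(submK lem0); apply: lem_add.
  rewrite mul_row_block mulmx0 add0r mulmxN !mulNmx opprK dv1 dv2.
  by rewrite addrK.
- have baseE : delta_mx 0 (base (cone phi)) =
      row_mx (delta_mx 0 (base F)) 0 :> 'rV[K]_(size_of F + size_of G).
    by rewrite delta_mx_lshift.
  move=> m; split.
    case=> v; rewrite -[v]hsubmxK /= => hv.
    set v1 := lsubmx v in hv *; set v2 := rsubmx v in hv *.
    rewrite mul_row_block baseE => /(congr1 lsubmx); rewrite !row_mxKl => dv.
    have [lem0|nlem0] := boolP (m0 <= m)%MM; first by right.
    left; apply/(dif_base FI); exists v1.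
      move=> a ha; have := hv (lshift _ a).
      by rewrite /below mdgl row_mxEl; apply.
    suff v20 : v2 = 0 by rewrite v20 mul0mx addr0 in dv.
    apply/rowP=> a; rewrite [RHS]mxE; apply/eqP/negPn/negP => ha.
    case/negP: nlem0.
    have := hv (rshift _ a); rewrite /below mdgr row_mxEr => /(_ ha).
    by apply: lepm_trans; apply/mnm_lepP=> i; rewrite mnmDE leq_addl.
  rewrite baseE /=; case=> [/(dif_base FI)[v hv dv]|lem0].
    exists (row_mx v 0); first exact: belowl.
    by rewrite mul_row_block !mul0mx mulmx0 !addr0 dv.
  (* [base G], now in homological degree 1, is the new generator [X^m0]. *)
  exists (row_mx 0 (delta_mx 0 (base G))).
    apply: supported_row_mx; first exact: supported0.
    by apply: supported_delta; rewrite /below mdgr (mdg_base GI) add0m.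
  rewrite mul_row_block !mul0mx mulmxN (row_dif_base GI) oppr0 !add0r.
  by rewrite -rowE phi0.
Qed.

End Cone.

End Complexes.

(** * Regularity of monomial ideals *)

Section MonomialOrder.
Variable n : nat.
Implicit Types (m : 'X_{1..n}) (a b : 'I_n).

Lemma mulm1_le a k m : (U_(a) *+ k <= m)%MM = (k <= m a)%N.
Proof.
apply/mnm_lepP/idP=> [/(_ a)|le_k b]; first by rewrite mulmnE mnm1E eqxx mul1n.
by rewrite mulmnE mnm1E; case: eqVneq => [<-|_] //; rewrite mul1n.
Qed.

Lemma addm_mulm1_le a b k m : a != b ->
  (U_(a) + U_(b) *+ k <= m)%MM = (0 < m a)%N && (k <= m b)%N.
Proof.
move=> nab; apply/mnm_lepP/andP => [le_m|[ma mb] c].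
  split; first by have := le_m a; rewrite mnmDE mnm1E eqxx; lia.
  have := le_m b; rewrite mnmDE mulmnE !mnm1E eqxx mul1n; lia.
rewrite mnmDE mulmnE !mnm1E; case: (eqVneq a c) => [<-|_].
  by rewrite eq_sym (negPf nab) mul0n.
by case: eqVneq => [<-|_] //; rewrite mul1n.
Qed.

End MonomialOrder.

Section Regularity.
Variables (K : fieldType) (n : nat).
Implicit Types (I J : 'X_{1..n} -> Prop) (V W : pred 'I_n) (m : 'X_{1..n}).

(* R / I has regularity rho, as witnessed by a minimal resolution whose
   multidegrees only involve the variables in V. *)
Definition regularity I V (rho : nat) : Prop :=
  exists C : mcomplex K n, [/\ resolution C I,
    forall (a : 'I_(size_of C)) i, mdg a i != 0%N -> V i,
    forall a : 'I_(size_of C), (mdeg (mdg a) <= hdg a + rho)%N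
  & exists a : 'I_(size_of C), mdeg (mdg a) = (hdg a + rho)%N].

Lemma eq_resolution (C : mcomplex K n) I J :
  (forall m, I m <-> J m) -> resolution C I -> resolution C J.
Proof. by move=> IJ []; split=> // m; rewrite -IJ. Qed.

Lemma eq_regularity I J V W rho : (forall m, I m <-> J m) ->
  (forall i, V i -> W i) -> regularity I V rho -> regularity J W rho.
Proof.
move=> IJ VW [C [CI CV le_C eq_C]]; exists C; split=> //.
- exact: eq_resolution CI.
- by move=> a i /CV /VW.
Qed.

Lemma regularity0 : regularity (fun=> False) pred0 0.
Proof.
pose C := MComplex (fun _ : 'I_1 => 0%N) (fun _ => 0%MM) 0 ord0 : mcomplex K n.
exists C; split; first split=> //=.
- by move=> a; rewrite !ord1.
- by move=> a b; rewrite mxE eqxx.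
- by move=> a b _; apply: lepm_refl.
- by move=> a b; rewrite mxE => /negP[].
- by rewrite mul0mx.
- move=> m u _ _ u0; exists 0; first exact: supported0.
  by rewrite mulmx0; apply/rowP=> a; rewrite ord1 u0 mxE.
- move=> m; split=> // -[v _]; rewrite mulmx0 => /rowP/(_ ord0)/eqP.
  by rewrite !mxE !eqxx eq_sym oner_eq0.
- by move=> a i; rewrite mnm0E.
- by move=> a; rewrite /= mdeg0.
- by exists ord0; rewrite /= mdeg0.
Qed.

(** Membership in [I] is read off from [below m], which only sees the exponents at variables in [V];
    a monomial free of these is a nonzerodivisor modulo [I]. *)
Lemma regularity_addm I V rho m m0 : regularity I V rho ->
  (forall i, V i -> m0 i = 0%N) -> I (m + m0)%MM <-> I m.
Proof.
case=> C [CI CV _ _] V0.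
have belowE (a : 'I_(size_of C)) : below (m + m0) a = below m a.
  apply/mnm_lepP/mnm_lepP=> le_a i; have := le_a i; rewrite mnmDE; last lia.
  have [->//|/CV/V0->] := eqVneq (mdg a i) 0%N; lia.
rewrite -!(dif_base CI); split=> -[v hv dv]; exists v => // a /hv.
  by rewrite belowE.
by rewrite belowE.
Qed.

(** A basis vector of [G] gains [mdeg m0] in degree and 1 in homological degree, whence the term
    [rho0 + (mdeg m0).-1]. The variable [i] occurs in every shifted multidegree of [G] and in none
    of [F], so the cone is minimal and both maxima survive. *)
Lemma regularity_cone I V rho V0 rho0 W m0 i :
    regularity I V rho -> regularity (fun m => I (m + m0)%MM) V0 rho0 ->
    ~~ V i -> m0 i != 0%N ->
    (forall j, V j || V0 j || (m0 j != 0%N) -> W j) ->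
  regularity (fun m => I m \/ (m0 <= m)%MM) W (maxn rho (rho0 + (mdeg m0).-1)).
Proof.
move=> [F [FI FV le_F [aF eq_F]]] [G [GI GV le_G [aG eq_G]]] Vi m0i sW.
have m0_gt0 : (0 < mdeg m0)%N.
  rewrite lt0n mdeg_eq0; apply: contraNneq m0i => ->.
  by rewrite mnm0E.
have [a b|phi CI] := cone_resolution FI GI.
  apply: contra Vi => /eqP eq_ab; apply: (FV b).
  by rewrite eq_ab mnmDE; lia.
exists (cone m0 phi); split=> //.
- move=> a j; case: (split_ordP a) => b -> /=.
    rewrite (unsplitK (inl b)) => /FV Vj.
    by apply: sW; rewrite Vj.
  rewrite (unsplitK (inr b)) mnmDE => h; apply: sW.
  by have [bj|/GV->] := eqVneq (mdg b j) 0%N; [rewrite -lt0n; lia|rewrite orbT].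
- move=> a; case: (split_ordP a) => b -> /=.
    by rewrite (unsplitK (inl b)); have := le_F b; lia.
  by rewrite (unsplitK (inr b)) mdegD; have := le_G b; lia.
- have [le_rho|lt_rho] := leqP (rho0 + (mdeg m0).-1) rho.
    by exists (lshift _ aF); rewrite /= (unsplitK (inl aF)).
  by exists (rshift _ aG); rewrite /= (unsplitK (inr aG)) mdegD; lia.
Qed.

(** Here [I : X^m0] is [I] itself, so the cone joins two copies of one resolution, and the shifted
    copy dominates. *)
Lemma regularity_disjoint I V rho W m0 : regularity I V rho -> m0 != 0%MM ->
    (forall j, V j -> m0 j = 0%N) ->
    (forall j, V j || (m0 j != 0%N) -> W j) ->
  regularity (fun m => I m \/ (m0 <= m)%MM) W (rho + (mdeg m0).-1).
Proof.
move=> rI nz V0 sW.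
have [i m0i] : exists i, m0 i != 0%N.
  apply/existsP; apply: contraNT nz => /existsPn m0z; apply/eqP/mnmP=> i.
  by rewrite mnm0E; apply/eqP; have := m0z i; rewrite negbK.
rewrite -[(rho + _)%N](maxn_idPr (leq_addr _ rho)).
apply: (regularity_cone (V0 := V) (i := i) rI) => //.
- apply: (eq_regularity _ _ rI) => // m.
  by apply: iff_sym; apply: (regularity_addm m rI).
- by apply: contraNN m0i => /V0->.
- by move=> j; rewrite orbb; apply: sW.
Qed.

(** Adjoining a fresh variable is the disjoint case in degree 1, which adds 0. *)
Lemma regularity_variables I V rho (s : seq 'I_n) : uniq s ->
    (forall i, i \in s -> ~~ V i) -> regularity I V rho ->
  regularity (fun m => I m \/ exists2 i, i \in s & (0 < m i)%N)
    (fun i => V i || (i \in s)) rho.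
Proof.
elim: s => [_ _|a s IHs /= /andP[nas us] sV rI].
  apply: eq_regularity => [m|i ->] //; split; first by left.
  by case=> // -[].
have rs := IHs us (fun i si => sV i (@mem_behead _ (a :: s) _ si)) rI.
have ras : regularity
    (fun m => (I m \/ exists2 i, i \in s & (0 < m i)%N) \/ (U_(a) <= m)%MM)
    (fun i => V i || (i \in a :: s)) (rho + (mdeg U_(a)).-1).
  apply: (regularity_disjoint rs); first by rewrite mnm1_eq0.
  - move=> j; rewrite mnm1E; case: eqVneq => // <-.
    by rewrite (negPf nas) orbF (negPf (sV a _)) // mem_head.
  - move=> j; rewrite mnm1E inE [j == a]eq_sym.
    by case: (eqVneq a j) => //= _; rewrite ?orbT ?orbF.
rewrite mdeg1 addn0 in ras; apply: eq_regularity ras => // m.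
rewrite lep1mP -lt0n; split.
  case=> [[Im|[i si mi]]|ma]; first by left.
    by right; exists i => //; rewrite inE si orbT.
  by right; exists a; rewrite ?mem_head.
case=> [Im|[i]]; first by left; left.
by rewrite inE => /orP[/eqP->|si] mi; [right|left; right; exists i].
Qed.

End Regularity.

(** * Forests with whiskers *)

Section IndependenceNumber.
Variables (T : finType) (e : rel T) (w : T -> nat).
Hypotheses (e_sym : ssrbool.symmetric e) (e_irr : irreflexive e).

Definition independent (A : {set T}) : bool :=
  [forall i in A, forall j in A, ~~ e i j].

Definition alpha (S : {set T}) : nat :=
  \max_(A : {set T} | (A \subset S) && independent A) \sum_(i in A) w i.

Lemma independentP (A : {set T}) :
  reflect {in A &, forall i j, ~~ e i j} (independent A).
Proof.
by apply: (iffP forall_inP) => [h i j iA jA|h i iA];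
   [have /forall_inP := h i iA; apply|apply/forall_inP=> j jA; apply: h].
Qed.

Lemma independent_le (A S : {set T}) : A \subset S -> independent A ->
  (\sum_(i in A) w i <= alpha S)%N.
Proof.
move=> AS iA.
apply: (leq_bigmax_cond (F := fun A : {set T} => \sum_(i in A) w i)%N).
by rewrite AS.
Qed.

Lemma alpha_attained (S : {set T}) : exists A : {set T},
  [/\ A \subset S, independent A & alpha S = (\sum_(i in A) w i)%N].
Proof.
have : (0 < #|[pred A : {set T} | (A \subset S) && independent A]|)%N.
  apply/card_gt0P; exists set0; rewrite inE sub0set.
  by apply/independentP=> i j; rewrite inE.
move=> /(eq_bigmax_cond (fun A : {set T} => \sum_(i in A) w i)%N)[A].
by rewrite inE => /andP[AS iA] eqA; exists A.
Qed.

Lemma alpha0 : alpha set0 = 0%N.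
Proof.
have [A []] := alpha_attained set0.
by rewrite subset0 => /eqP-> _ ->; rewrite big_set0.
Qed.

Lemma alpha_mono (S T' : {set T}) : T' \subset S -> (alpha T' <= alpha S)%N.
Proof.
move=> TS; have [A [AT iA ->]] := alpha_attained T'.
by apply: independent_le => //; apply: subset_trans AT TS.
Qed.

Lemma alpha_add (S T' : {set T}) i : T' \subset S -> i \in S -> i \notin T' ->
  {in T', forall j, ~~ e i j} -> (alpha T' + w i <= alpha S)%N.
Proof.
move=> TS iS niT eT; have [A [AT iA ->]] := alpha_attained T'.
have niA : i \notin A by apply: contra niT; apply/subsetP.
have -> : (\sum_(j in A) w j + w i)%N = (\sum_(j in i |: A) w j)%N.
  by rewrite big_setU1 //= addnC.
apply: independent_le.
  by rewrite subUset sub1set iS (subset_trans AT).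
apply/independentP=> j k; rewrite !inE.
case/predU1P=> [->|jA] /predU1P[->|kA].
- by rewrite e_irr.
- by apply: eT; apply: (subsetP AT).
- by rewrite e_sym; apply: eT; apply: (subsetP AT).
- exact: (independentP _ iA).
Qed.

(** An optimal set for [S] either avoids [i], or consists of [i] and an independent subset of
    [T']. *)
Lemma alpha_le (S T' : {set T}) i :
    (forall j, j \in S -> j != i -> ~~ e i j -> j \in T') ->
  (alpha S <= maxn (alpha (S :\ i)) (alpha T' + w i))%N.
Proof.
move=> ST; have [A [AS iA ->]] := alpha_attained S.
rewrite leq_max; have [Ai|nAi] := boolP (i \in A); last first.
  rewrite independent_le //.
  apply/subsetP=> j jA; rewrite !inE (subsetP AS) // andbT.
  by apply: contraNneq nAi => <-.
apply/orP; right; rewrite (big_setD1 i) //= addnC leq_add2r.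
apply: independent_le.
  apply/subsetP=> j /setD1P[ji jA]; apply: ST => //; first exact: (subsetP AS).
  exact: (independentP _ iA).
apply/independentP=> j k /setD1P[_ jA] /setD1P[_ kA].
exact: (independentP _ iA).
Qed.

End IndependenceNumber.

(** * The regularity recursion on whiskered forests *)

Section Whiskers.
Variables (K : fieldType) (n r : nat) (X Y : 'I_r -> 'I_n) (w : 'I_r -> nat).
Variable e : rel 'I_r.
Hypotheses (X_inj : injective X) (Y_inj : injective Y).
Hypothesis XY : forall i j, X i != Y j.
Hypothesis w_gt0 : forall i, (0 < w i)%N.
Hypotheses (e_sym : ssrbool.symmetric e) (e_irr : irreflexive e).
(** The form in which acyclicity is used: every nonempty induced subgraph has a vertex of degree at
    most one. *)
Hypothesis leaf : forall S : {set 'I_r}, S != set0 -> exists2 i, i \in S &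
  {in S &, forall j k, e i j -> e i k -> j = k}.

(* The monomials of the ideal generated by the X_i Y_i^(w i) and the X_i X_j
   with e i j, for i and j in S. *)
Definition whisker (S : {set 'I_r}) (m : 'X_{1..n}) : Prop :=
  exists i, [/\ i \in S, (0 < m (X i))%N
    & (w i <= m (Y i))%N \/ exists j, [/\ j \in S, e i j & (0 < m (X j))%N]].

Definition whisker_vars (S : {set 'I_r}) : pred 'I_n :=
  fun v => [exists i in S, (v == X i) || (v == Y i)].

Implicit Types (S T : {set 'I_r}) (m : 'X_{1..n}).

Lemma whisker_varsX S i : whisker_vars S (X i) = (i \in S).
Proof.
apply/exists_inP/idP => [[j jS]|iS]; last by exists i; rewrite ?eqxx.
by rewrite (negPf (XY _ _)) orbF => /eqP/X_inj->.
Qed.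

Lemma whisker_varsY S i : whisker_vars S (Y i) = (i \in S).
Proof.
apply/exists_inP/idP => [[j jS]|iS]; last by exists i; rewrite ?eqxx ?orbT.
by rewrite eq_sym (negPf (XY _ _)) => /eqP/Y_inj->.
Qed.

Lemma whisker_varsS S T v : S \subset T -> whisker_vars S v -> whisker_vars T v.
Proof.
move=> ST /exists_inP[i iS hi]; apply/exists_inP; exists i => //.
exact: (subsetP ST).
Qed.

Lemma whisker_mono S T m : S \subset T -> whisker S m -> whisker T m.
Proof.
move=> /subsetP ST [i [iS mi h]]; exists i; split=> //; first exact: ST.
case: h => [h|[j [jS eij mj]]]; [by left|right; exists j; split=> //].
exact: ST.
Qed.

(** The generator [X_i Y_i^(w i)] shares no variable with the others, so it adds its degree minus
    one, that is [w i]; [alpha] grows by the same amount since [i] can join any independent set. *)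
Lemma regularity_whisker_isolated S i : i \in S ->
    {in S, forall j, ~~ e i j} ->
    regularity K (whisker (S :\ i)) (whisker_vars (S :\ i))
      (alpha e w (S :\ i)) ->
  regularity K (whisker S) (whisker_vars S) (alpha e w S).
Proof.
move=> iS eS rT.
have -> : alpha e w S =
    (alpha e w (S :\ i) + (mdeg (U_(X i) + U_(Y i) *+ w i)%MM).-1)%N.
  rewrite mdegD mdegMn !mdeg1 mul1n; apply/eqP; rewrite eqn_leq.
  apply/andP; split; last first.
    apply: alpha_add => //; first exact: subD1set.
      by rewrite !inE eqxx.
    by move=> j /setD1P[_]; apply: eS.
  apply: leq_trans (alpha_le w (T' := S :\ i) (i := i) (e := e) _) _.
  2: by rewrite add1n /= geq_max leqnn leq_addr.
  by move=> j jS ji _; rewrite !inE ji.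
have rI := regularity_disjoint (m0 := (U_(X i) + U_(Y i) *+ w i)%MM)
  (W := whisker_vars S) rT.
apply: eq_regularity (rI _ _ _) => // [m||j|j].
- rewrite addm_mulm1_le //; split.
    case=> [|/andP[mx my]]; first by apply: whisker_mono; apply: subD1set.
    by exists i; split=> //; left.
  case=> j [jS mj h]; have [eji|nji] := eqVneq j i.
    right; rewrite -eji mj; case: h => // -[k [kS]].
    by rewrite eji (negPf (eS _ kS)).
  left; exists j; split=> //; first by rewrite !inE nji.
  case: h => [h|[k [kS ejk mk]]]; [by left|right; exists k; split=> //].
  rewrite !inE kS andbT; apply: contraTneq ejk => ->.
  by rewrite e_sym; apply: eS.
- by rewrite -mdeg_eq0 mdegD mdeg1.
- move=> /exists_inP[k /setD1P[ki kS]] jk.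
  rewrite mnmDE mulmnE !mnm1E.
  have ik : (i == k) = false by rewrite eq_sym (negPf ki).
  case/orP: jk => /eqP->; last first.
    by rewrite (negPf (XY _ _)) (inj_eq Y_inj) ik mul0n.
  by rewrite [Y i == _]eq_sym (negPf (XY _ _)) (inj_eq X_inj) ik mul0n.
- case/orP=> [|h]; first by apply: whisker_varsS; apply: subD1set.
  apply/exists_inP; exists i => //; move: h.
  rewrite mnmDE mulmnE !mnm1E ![_ == j]eq_sym.
  by case: (j == X i) => //; case: (j == Y i).
Qed.

(* The colon by X_k of the ideal of T is generated by Y_k^(w k), by the X_l with
   l adjacent to k, and by the ideal of the vertices outside of these. *)
Lemma regularity_whisker_colon T k : k \in T ->
    let P := [set l in T | e k l] in
    regularity K (whisker (T :\ k :\: P)) (whisker_vars (T :\ k :\: P))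
      (alpha e w (T :\ k :\: P)) ->
  forall m0, (m0 (X k) = 1)%N ->
    (forall l, l \in T -> l != k -> m0 (X l) = 0%N) ->
    (forall l, l \in T -> m0 (Y l) = 0%N) ->
  regularity K (fun m => whisker T (m + m0)%MM) (whisker_vars T)
    (alpha e w (T :\ k :\: P) + (w k).-1).
Proof.
move=> kT P rT' m0 m0k m0X m0Y; set T' := T :\ k :\: P in rT' *.
have T'T : T' \subset T by rewrite (subset_trans (subsetDl _ _)) ?subD1set.
have nkT' : k \notin T' by rewrite !inE eqxx andbF.
(* First [Y_k^(w k)] is adjoined, which adds [w k - 1]; then the variables of the neighbours of [k],
   which add nothing. *)
have rY : regularity K (fun m => whisker T' m \/ (U_(Y k) *+ w k <= m)%MM)
    (fun v => whisker_vars T' v || (v == Y k))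
    (alpha e w T' + (mdeg (U_(Y k) *+ w k)%MM).-1).
  apply: (regularity_disjoint rT').
  - by rewrite -mdeg_eq0 mdegMn mdeg1 mul1n -lt0n.
  - move=> j Vj; rewrite mulmnE mnm1E; case: eqVneq Vj => // <-.
    by rewrite whisker_varsY (negPf nkT').
  - move=> j; rewrite mulmnE mnm1E [_ == j]eq_sym.
    by case: (j == Y k); rewrite ?orbT ?orbF // mul0n orbF.
rewrite mdegMn mdeg1 mul1n in rY.
have us : uniq [seq X l | l <- enum P] by rewrite map_inj_uniq ?enum_uniq.
have sV i : i \in [seq X l | l <- enum P] ->
    ~~ (whisker_vars T' i || (i == Y k)).
  move=> /mapP[l]; rewrite mem_enum inE => /andP[lT ekl] ->.
  by rewrite whisker_varsX (negPf (XY _ _)) orbF !inE lT ekl.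
apply: (eq_regularity _ _ (regularity_variables us sV rY)).
- move=> m; rewrite mulm1_le; split.
    case=> [[|my]|[_ /mapP[l + ->] ml]].
    + case=> i [iT' mi h]; exists i; split; first exact: (subsetP T'T).
        by rewrite mnmDE; lia.
      case: h => [h|[j [jT' eij mj]]]; first by left; rewrite mnmDE; lia.
      right; exists j; split=> //; first exact: (subsetP T'T).
      by rewrite mnmDE; lia.
    + exists k; split; rewrite ?mnmDE ?m0k; [by []|lia|].
      by left; lia.
    + rewrite mem_enum inE => /andP[lT ekl].
      exists k; split; rewrite ?mnmDE ?m0k; [by []|lia|].
      by right; exists l; split=> //; rewrite mnmDE; lia.
  (* A generator [X_i X_j] avoiding [X_k] survives in [T'], unless one of its ends is a neighbour of
     [k], whose variable then divides [m]. *)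
  have main i j : i \in T -> j \in T -> e i j ->
      (0 < (m + m0)%MM (X i))%N -> (0 < (m + m0)%MM (X j))%N ->
      i != k -> j != k ->
      (whisker T' m \/ (w k <= m (Y k))%N) \/
      exists2 v, v \in [seq X l | l <- enum P] & (0 < m v)%N.
    move=> iT jT eij; rewrite !mnmDE => mi mj ik jk.
    rewrite !m0X // !addn0 in mi mj.
    have [iP|niP] := boolP (i \in P).
      by right; exists (X i) => //; rewrite map_f // mem_enum.
    have [jP|njP] := boolP (j \in P).
      by right; exists (X j) => //; rewrite map_f // mem_enum.
    left; left; exists i; split=> //; first by rewrite in_setD niP !inE ik.
    by right; exists j; split=> //; rewrite in_setD njP !inE jk.
  have nbr l : l \in T -> e k l -> (0 < (m + m0)%MM (X l))%N ->
      exists2 v, v \in [seq X l | l <- enum P] & (0 < m v)%N.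
    move=> lT ekl; rewrite mnmDE m0X ?addn0 //; last first.
      by apply: contraTneq ekl => ->; rewrite e_irr.
    by exists (X l) => //; rewrite map_f // mem_enum inE lT.
  case=> i [iT mi h]; have [eik|nik] := eqVneq i k.
    rewrite eik in h; case: h => [|[l [lT ekl ml]]].
      by rewrite mnmDE m0Y // addn0 => h; left; right.
    by right; apply: (nbr l).
  have [iP|niP] := boolP (i \in P).
    by right; apply: (nbr i) => //; move: iP; rewrite inE => /andP[].
  case: h => [|[j [jT eij mj]]]; last first.
    have [ejk|njk] := eqVneq j k; last exact: (main i j).
    by case/negP: niP; rewrite inE iT e_sym -ejk.
  rewrite !mnmDE m0Y // addn0 in mi * => h; left; left; exists i; split=> //.
  - by rewrite in_setD niP !inE nik.
  - by move: mi; rewrite m0X // addn0.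
  - by left.
- move=> v /orP[/orP[|/eqP->]|/mapP[l + ->]].
  + exact: whisker_varsS.
  + by rewrite whisker_varsY.
  + by rewrite mem_enum inE whisker_varsX => /andP[].
Qed.

Lemma regularity_whisker_leaf S i k : i \in S -> k \in S -> e i k ->
    {in S, forall j, e i j -> j = k} ->
    (forall T, (#|T| < #|S|)%N ->
      regularity K (whisker T) (whisker_vars T) (alpha e w T)) ->
  regularity K (whisker S) (whisker_vars S) (alpha e w S).
Proof.
move=> iS kS eik eik_uniq IH; set T := S :\ i.
have ki : k != i by apply: contraTneq eik => ->; rewrite e_irr.
have kT : k \in T by rewrite !inE ki.
have TS : T \subset S by apply: subD1set.
have niT : i \notin T by rewrite !inE eqxx.
have cardT : (#|T| < #|S|)%N by rewrite (cardsD1 i S) iS.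
set P := [set l in T | e k l]; set T' := T :\ k :\: P.
have cardTk : (#|T :\ k| < #|S|)%N.
  by apply: leq_ltn_trans cardT; apply: subset_leq_card; apply: subD1set.
have cardT' : (#|T'| < #|S|)%N.
  by apply: leq_ltn_trans cardTk; apply: subset_leq_card; apply: subsetDl.
have Xik : X i != X k by rewrite (inj_eq X_inj) eq_sym.
(* The trivial multiple [*+ 1] lets [addm_mulm1_le] treat both monomials. *)
pose m1 : 'X_{1..n} := (U_(X i) + U_(X k) *+ 1)%MM.
pose m2 : 'X_{1..n} := (U_(X i) + U_(Y i) *+ w i)%MM.
have m1E v : m1 v = ((v == X i) + (v == X k))%N.
  by rewrite mnmDE mulmnE muln1 !mnm1E ![_ == v]eq_sym.
have m2E v : m2 v = ((v == X i) + (v == Y i) * w i)%N.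
  by rewrite mnmDE mulmnE !mnm1E ![_ == v]eq_sym.
have YX a b : (Y a == X b) = false by rewrite eq_sym (negPf (XY _ _)).
have XX a b : (X a == X b) = (a == b) by rewrite (inj_eq X_inj).
have YY a b : (Y a == Y b) = (a == b) by rewrite (inj_eq Y_inj).
have rT := IH _ cardT.
pose V1 v := whisker_vars T v || (v == X i).
have r1 : regularity K (fun m => whisker T m \/ (m1 <= m)%MM) V1 (alpha e w T).
  have r0 : regularity K (fun m => whisker T (m + m1)%MM) (whisker_vars T)
      (alpha e w T' + (w k).-1).
    apply: regularity_whisker_colon => //; first exact: IH.
    - by rewrite m1E !XX eqxx (negPf ki).
    - by move=> l; rewrite !inE m1E !XX => /andP[/negPf-> _] /negPf->.
    - by move=> l _; rewrite m1E !YX.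
  (* The second term is [alpha T' + w k]. As [k] has no neighbour in [T'], it is at most [alpha T],
     and the first cone leaves the regularity unchanged. *)
  have <- : maxn (alpha e w T) (alpha e w T' + (w k).-1 + (mdeg m1).-1)%N
      = alpha e w T.
    apply/maxn_idPl; rewrite mdegD mdegMn !mdeg1 /=.
    rewrite -addnA addn1 prednK //; apply: alpha_add => //.
    - by rewrite (subset_trans (subsetDl _ _)) ?subD1set.
    - by rewrite !inE eqxx andbF.
    - by move=> j /setDP[/setD1P[_ jT]]; rewrite inE jT.
  apply: (regularity_cone (i := X i) rT r0).
  - by rewrite whisker_varsX.
  - by rewrite m1E eqxx.
  - move=> v; rewrite orbb /V1 m1E.
    case: (eqVneq v (X k)) => [->|_]; first by rewrite whisker_varsX kT.
    by case: (v == X i); case: (whisker_vars T v).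
(* As [X_i] divides [m2], the colon of [m1] by [m2] is [X_k], and modulo [X_k] the ideal of [T]
   becomes that of [T :\ k]. *)
have r2 : regularity K (fun m => whisker T (m + m2)%MM \/ (m1 <= m + m2)%MM)
    (whisker_vars T) (alpha e w (T :\ k)).
  have rTk : regularity K (fun m => whisker (T :\ k) m \/ (U_(X k) <= m)%MM)
      (whisker_vars T) (alpha e w (T :\ k) + (mdeg U_(X k)).-1).
    apply: (regularity_disjoint (IH _ cardTk)); first by rewrite mnm1_eq0.
    - move=> v Vv; rewrite mnm1E; case: eqVneq Vv => // <-.
      by rewrite whisker_varsX !inE eqxx.
    - move=> v; rewrite mnm1E; case: (eqVneq (X k) v) => [<-|_].
        by rewrite [whisker_vars T _]whisker_varsX kT.
      by rewrite orbF; apply: whisker_varsS; apply: subD1set.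
  rewrite mdeg1 addn0 in rTk; apply: eq_regularity rTk => // m.
  have m2X l : l \in T -> (m + m2)%MM (X l) = m (X l).
    rewrite !inE => /andP[/negPf nli _].
    by rewrite mnmDE m2E XX nli (negPf (XY _ _)) addn0.
  have m2Y l : l \in T -> (m + m2)%MM (Y l) = m (Y l).
    rewrite !inE => /andP[/negPf nli _].
    by rewrite mnmDE m2E YX YY nli addn0.
  rewrite lep1mP -lt0n /m1 addm_mulm1_le // (m2X k) //; split.
    case=> [[l [lT ml h]]|mk]; last first.
      by right; rewrite mk andbT mnmDE m2E eqxx; lia.
    have lT' : l \in T by move: lT; rewrite !inE => /andP[].
    left; exists l; split; rewrite ?m2X ?m2Y //.
    case: h => [|[j [jT elj mj]]]; [by left|right; exists j].
    have jT' : j \in T by move: jT; rewrite !inE => /andP[].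
    by rewrite m2X.
  case=> [[l [lT ml h]]|/andP[_ mk]]; last by right.
  rewrite m2X // in ml; rewrite m2Y // in h.
  have [elk|nlk] := eqVneq l k; first by right; rewrite -elk.
  case: h => [h|[j [jT elj mj]]].
    left; exists l; split=> //; last by left.
    by rewrite in_setD1 nlk.
  rewrite m2X // in mj.
  have [ejk|njk] := eqVneq j k; first by right; rewrite -ejk.
  left; exists l; split=> //; first by rewrite in_setD1 nlk.
  by right; exists j; split=> //; rewrite in_setD1 njk.
(* An optimal independent set of [S] lies in [T], or contains the leaf [i] and omits its neighbour
   [k]. *)
have alphaE : maxn (alpha e w T) (alpha e w (T :\ k) + (mdeg m2).-1)%N
    = alpha e w S.
  rewrite mdegD mdegMn !mdeg1 mul1n add1n /=; apply/eqP; rewrite eqn_leq.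
  apply/andP; split; last first.
    apply: alpha_le => j jS ji; rewrite !inE jS ji andbT /= andbT.
    by apply: contraNneq => ->.
  rewrite geq_max alpha_mono //=; apply: alpha_add => //.
  - by rewrite (subset_trans (subD1set _ _)).
  - by rewrite !inE eqxx andbF.
  - move=> j; rewrite !inE => /and3P[jk _ jS]; apply: contraNN jk => eij.
    by apply/eqP; apply: eik_uniq.
rewrite -alphaE.
have rS : regularity K (fun m => (whisker T m \/ (m1 <= m)%MM) \/ (m2 <= m)%MM)
    (whisker_vars S) (maxn (alpha e w T) (alpha e w (T :\ k) + (mdeg m2).-1)).
  (* [X_i] already occurs after the first cone; the fresh variable is now [Y_i]. *)
  apply: (regularity_cone (i := Y i) r1 r2).
  - by rewrite /V1 whisker_varsY (negPf niT) YX.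
  - by rewrite m2E eqxx; have := w_gt0 i; lia.
  - move=> v; rewrite m2E /V1.
    case: (eqVneq v (X i)) => [->|_].
      by rewrite [whisker_vars S _]whisker_varsX iS.
    case: (eqVneq v (Y i)) => [->|_].
      by rewrite [whisker_vars S _]whisker_varsY iS.
    by rewrite !orbF orbb; apply: whisker_varsS.
apply: eq_regularity rS => // m; rewrite /m1 /m2 !addm_mulm1_le //; split.
  case=> [[|/andP[mi mk]]|/andP[mi my]]; first exact: whisker_mono.
    by exists i; split=> //; right; exists k.
  by exists i; split=> //; left.
case=> j [jS mj h]; have [eji|nji] := eqVneq j i.
  rewrite eji in mj h; case: h => [h|[l [lS eil ml]]].
    by right; rewrite mj.
  by left; right; rewrite mj -(eik_uniq l).
case: h => [h|[l [lS ejl ml]]].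
  by left; left; exists j; split=> //; [rewrite in_setD1 nji|left].
have [eli|nli] := eqVneq l i.
  left; right; rewrite -eli ml -(eik_uniq j) //.
  by rewrite e_sym -eli.
left; left; exists j; split=> //; first by rewrite in_setD1 nji.
by right; exists l; split=> //; rewrite in_setD1 nli.
Qed.

(** Strong induction on [#|S|]: the vertex given by [leaf] is isolated in [S] or has exactly one
    neighbour there. *)
Theorem regularity_whisker S :
  regularity K (whisker S) (whisker_vars S) (alpha e w S).
Proof.
have [N] := ubnP #|S|; elim: N S => // N IHN S; rewrite ltnS => leSN.
have IH T : (#|T| < #|S|)%N ->
    regularity K (whisker T) (whisker_vars T) (alpha e w T).
  by move=> ltT; apply: IHN; apply: leq_trans ltT leSN.
have [->|/leaf[i iS uniq_i]] := eqVneq S set0.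
  rewrite alpha0; apply: eq_regularity (regularity0 K n) => // m; split=> //.
  by case=> i []; rewrite inE.
case: (pickP [pred k in S | e i k]) => [k /andP[kS eik]|noe].
  by apply: (regularity_whisker_leaf iS kS eik) => // j jS eij; apply: uniq_i.
apply: (regularity_whisker_isolated iS).
  by move=> j jS; have := noe j; rewrite /= jS => /= ->.
by apply: IH; rewrite [X in (_ < X)%N](cardsD1 i) iS.
Qed.

End Whiskers.

(** * From multigraded complexes to free resolutions *)

Section FreeComplex.
Variables (K : fieldType) (n : nat).
Local Notation R := {mpoly K[n]}.
Implicit Types (m k : 'X_{1..n}) (p : R).

Lemma mcoeffMX_le p k m :
  (p * 'X_[k])@_m = if (k <= m)%MM then p@_(m - k) else 0.
Proof.
case: ifP => [le_km|/negP nle].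
  by rewrite -[X in _@_X = _](submK le_km) addmC mcoeffMX.
apply/eqP; rewrite mcoeff_eq0; apply/negP; rewrite (perm_mem (msuppMX _ _)).
case/mapP=> k' _ eq_m; apply: nle.
by rewrite eq_m; apply/mnm_lepP=> i; rewrite mnmDE leq_addr.
Qed.

Variables (C : mcomplex K n) (I : 'X_{1..n} -> Prop) (CI : resolution C I).
Local Notation N := (size_of C).
Implicit Types (U V : 'rV[R]_N) (u v : 'rV[K]_N).

Definition poly_dif : 'M[R]_N :=
  \matrix_(a, b) (dif C a b *: 'X_[mdg a - mdg b]).

(** Coordinates of the component of [U] of multidegree [m] in the basis [X^(m - mdg a) * a] of the
    strand. *)
Definition piece m U : 'rV[K]_N :=
  \row_a (if (mdg a <= m)%MM then (U 0 a)@_(m - mdg a) else 0).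

(** Embeds the strand of [m] back into the free module; meaningful only on vectors supported in
    [below m], because the subtraction of exponents is truncated. *)
Definition unpiece m u : 'rV[R]_N := \row_a (u 0 a *: 'X_[m - mdg a]).

Lemma pieceD m U V : piece m (U + V) = piece m U + piece m V.
Proof.
by apply/rowP=> a; rewrite !mxE; case: ifP => _; rewrite ?mcoeffD ?addr0.
Qed.

Lemma supported_piece m U : supported (@below K n C m) (piece m U).
Proof. by move=> a; rewrite mxE /below; case: ifP => //; rewrite eqxx. Qed.

Lemma piece_inj U V : (forall m, piece m U = piece m V) -> U = V.
Proof.
move=> eqUV; apply/rowP=> a; apply/mpolyP=> m.
have /rowP/(_ a) := eqUV (m + mdg a)%MM; rewrite !mxE addmK.
by case: ifP => // /mnm_lepP[] i; rewrite mnmDE leq_addl.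
Qed.

(** [X^(m - mdg a)] times [X^(mdg a - mdg b)] is [X^(m - mdg b)], so only the scalars remain in a
    strand. *)
Lemma piece_dif m U : piece m (U *m poly_dif) = piece m U *m dif C.
Proof.
apply/rowP=> b; rewrite !mxE; case: ifP => [le_bm|nle_bm]; last first.
  rewrite big1 // => a _; rewrite mxE; case: ifP => le_am; last exact: mul0r.
  have [->|/(dif_mdg CI) le_ba] := eqVneq (dif C a b) 0; first by rewrite mulr0.
  by move: nle_bm; rewrite (lepm_trans le_ba le_am).
rewrite raddf_sum; apply: eq_bigr => a _; rewrite !mxE /=.
rewrite -scalerAr mcoeffZ mulrC mcoeffMX_le.
have [->|/(dif_mdg CI) le_ba] := eqVneq (dif C a b) 0; first by rewrite !mulr0.
congr (_ * _).
have -> : (mdg a - mdg b <= m - mdg b)%MM = (mdg a <= m)%MM.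
  move/mnm_lepP: le_bm => le_bm; move/mnm_lepP: le_ba => le_ba.
  by apply/mnm_lepP/mnm_lepP=> h i; have := h i; have := le_bm i;
    have := le_ba i; rewrite ?mnmBE; lia.
case: ifP => // _; congr (_ @_ _); apply/mnmP=> i; rewrite !mnmBE.
by move/mnm_lepP: le_ba => /(_ i); lia.
Qed.

Lemma piece_unpiece m k u : supported (@below K n C k) u ->
  piece m (unpiece k u) = if m == k then u else 0.
Proof.
move=> hu; apply/rowP=> a; rewrite !mxE.
have [u0|/hu le_ak] := eqVneq (u 0 a) 0.
  by rewrite u0 scale0r mcoeff0 if_same; case: ifP; rewrite ?mxE ?u0.
rewrite mcoeffZ mcoeffX; have [->|nmk] := eqVneq m k.
  by rewrite [X in if X then _ else _]le_ak eqxx mulr1.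
rewrite mxE; case: ifP => // le_am.
case: eqP => [eq_d|_]; last by rewrite mulr0.
by case/eqP: nmk; rewrite -(submK le_am) -(submK le_ak) eq_d.
Qed.

(** A preimage is chosen in each of the finitely many strands, and their sum is taken. *)
Lemma poly_dif_lift (s : seq 'X_{1..n}) (f : 'X_{1..n} -> 'rV[K]_N) : uniq s ->
    (forall m, m \in s ->
      exists2 v, supported (@below K n C m) v & v *m dif C = f m) ->
  exists V, forall m, piece m (V *m poly_dif) = if m \in s then f m else 0.
Proof.
elim: s => [_ _|k s IHs /= /andP[nks us] fP].
  exists 0 => m; rewrite mul0mx; apply/rowP=> a.
  by rewrite !mxE mcoeff0 if_same.
have [m ms|V hV] := IHs us; first by apply: fP; rewrite inE ms orbT.
have [v hv dv] := fP k (mem_head _ _).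
exists (V + unpiece k v) => m; rewrite mulmxDl pieceD hV piece_dif.
rewrite piece_unpiece // inE; case: eqVneq => [->|_] /=.
  by rewrite (negPf nks) add0r.
by rewrite mul0mx addr0.
Qed.

Lemma piece_support U : exists2 s : seq 'X_{1..n}, uniq s &
  forall m, m \notin s -> piece m U = 0.
Proof.
exists (undup [seq (k + mdg a)%MM | a <- enum 'I_N, k <- msupp (U 0 a)]).
  exact: undup_uniq.
move=> m; rewrite mem_undup => nms; apply/rowP=> a; rewrite !mxE.
case: ifP => // le_am; apply/eqP; rewrite mcoeff_eq0; apply: contra nms => h.
apply/allpairsPdep; exists a, (m - mdg a)%MM; split=> //.
  by rewrite mem_enum.
by rewrite submK.
Qed.

Lemma poly_dif_sq U : U *m poly_dif *m poly_dif = 0.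
Proof.
apply: piece_inj => m; rewrite !piece_dif -mulmxA (dif_sq CI) mulmx0.
by apply/rowP=> a; rewrite !mxE mcoeff0 if_same.
Qed.

Lemma poly_dif_exact U : U *m poly_dif = 0 -> U 0 (base C) = 0 ->
  exists V, V *m poly_dif = U.
Proof.
move=> dU Ub; have [s us sP] := piece_support U.
have [m _|V hV] := poly_dif_lift (f := fun m => piece m U) us; last first.
  exists V; apply: piece_inj => m; rewrite hV.
  by case: ifP => // /negbT/sP.
apply: (dif_exact CI); first exact: supported_piece.
  by rewrite -piece_dif dU; apply/rowP=> a; rewrite !mxE mcoeff0 if_same.
by rewrite mxE Ub mcoeff0 if_same.
Qed.

Lemma piece_base m p :
  piece m (p *: delta_mx 0 (base C)) = p@_m *: delta_mx 0 (base C).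
Proof.
apply/rowP=> a; rewrite !mxE eqxx /=; case: eqVneq => [->|_].
  rewrite (mdg_base CI) subm0 !mulr1; case: ifP => // /mnm_lepP[] i.
  by rewrite mnm0E.
by rewrite !mulr0 mcoeff0 if_same.
Qed.

Lemma poly_dif_base p :
  (exists V, V *m poly_dif = p *: delta_mx 0 (base C)) <->
  (forall m, m \in msupp p -> I m).
Proof.
split=> [[V hV] m|Ip].
  rewrite mcoeff_msupp => pm.
  apply: (base_boundary CI (u := piece m V) pm); first exact: supported_piece.
  by rewrite -piece_dif hV piece_base !mxE !eqxx mulr1.
have [m /Ip Im|V hV] := poly_dif_lift (s := msupp p)
    (f := fun m => p@_m *: delta_mx 0 (base C)) (msupp_uniq p).
  have [v hv dv] := (dif_base CI m).2 Im.
  by exists (p@_m *: v); [apply: supportedZ|rewrite -scalemxAl dv].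
exists V; apply: piece_inj => m; rewrite hV piece_base.
by case: ifP => // /negbT; rewrite -mcoeff_eq0 => /eqP->; rewrite scale0r.
Qed.

Definition hdg_proj (k : nat) : 'M[R]_N := diag_mx (\row_a (hdg a == k)%:R).

Lemma poly_dif_proj (k : nat) :
  poly_dif *m hdg_proj k = hdg_proj k.+1 *m poly_dif.
Proof.
apply/matrixP=> a b; rewrite mul_mx_diag mul_diag_mx !mxE.
have [->|/(dif_hdg CI)->] := eqVneq (dif C a b) 0.
  by rewrite scale0r mulr0 mul0r.
by rewrite eqSS mulrC.
Qed.

(** The rows of [A] form an orthonormal frame of the part of homological degree [k]: [A] includes
    the free module of rank [q] and [A^T] projects back. Frames split the single module into the
    terms of a complex. *)
Definition hdg_frame (k : nat) q (A : 'M[R]_(q, N)) : Prop :=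
  A *m A^T = 1%:M /\ A^T *m A = hdg_proj k.

Lemma poly_dif_frame (k : nat) q1 q2 q3 (A : 'M_(q1, N)) (B : 'M_(q2, N))
    (D : 'M_(q3, N)) (u : 'rV[R]_q2) :
    hdg_frame k.+2 A -> hdg_frame k.+1 B -> hdg_frame k D ->
  u *m (B *m poly_dif *m D^T) = 0 <->
  exists v : 'rV[R]_q1, u = v *m (A *m poly_dif *m B^T).
Proof.
move=> [AA Ap] [BB Bp] [DD Dp].
have projA : A *m hdg_proj k.+2 = A by rewrite -Ap mulmxA AA mul1mx.
have projB : B *m hdg_proj k.+1 = B by rewrite -Bp mulmxA BB mul1mx.
split=> [u0|[v ->]]; last first.
  rewrite !mulmxA -(mulmxA _ B^T B) Bp -(mulmxA _ poly_dif (hdg_proj _)).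
  by rewrite poly_dif_proj !mulmxA -(mulmxA v) projA poly_dif_sq mul0mx.
have dU : u *m B *m poly_dif = 0.
  rewrite -projB !mulmxA -(mulmxA _ (hdg_proj _)) -poly_dif_proj -Dp !mulmxA.
  by move: u0; rewrite !mulmxA => ->; rewrite mul0mx.
(* In positive homological degree the coefficient at the base vector vanishes, as exactness
   requires. *)
have [|V hV] := poly_dif_exact dU _.
  rewrite -projB mulmxA mul_mx_diag !mxE.
  by have := hdg_eq0 CI (base C); rewrite eqxx => /eqP->; rewrite mulr0.
exists (V *m A^T).
rewrite !mulmxA -(mulmxA V A^T A) Ap -(mulmxA V) -poly_dif_proj -Bp !mulmxA hV.
by rewrite -!mulmxA BB !mulmx1 BB mulmx1.
Qed.

(** The shift by one passes from the resolution of [R/I] to that of [I]: homological degree 1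
    becomes the term [F_0], and the map onto the base component becomes the augmentation. *)
Definition layer i : {set 'I_N} := [set a | hdg a == i.+1].

Definition layer_frame i : 'M[R]_(#|layer i|, N) :=
  \matrix_(a, b) (enum_val a == b)%:R.

Lemma layer_frameP i : hdg_frame i.+1 (layer_frame i).
Proof.
split; apply/matrixP=> a b; rewrite !mxE.
  rewrite (bigD1 (enum_val a)) //= big1 => [|c nca].
    by rewrite !mxE eqxx mul1r addr0 [in LHS]eq_sym (inj_eq enum_val_inj).
  by rewrite !mxE eq_sym (negPf nca) mul0r.
have [la|nla] := boolP (a \in layer i).
  rewrite (bigD1 (enum_rank_in la a)) //= big1 => [|c nca].
    rewrite !mxE enum_rankK_in // eqxx mul1r addr0.
    by move: la; rewrite inE => /eqP->; rewrite eqxx; case: eqP.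
  rewrite !mxE; case: eqP => [eca|_]; last by rewrite mul0r.
  by case/eqP: nca; apply: enum_val_inj; rewrite enum_rankK_in.
rewrite big1 => [|c _].
  by move: nla; rewrite inE => /negPf->; rewrite mul0rn.
rewrite !mxE; case: eqP => [eca|_]; last by rewrite mul0r.
by case/negP: nla; rewrite -eca enum_valP.
Qed.

Definition base_frame : 'M[R]_(1, N) := delta_mx 0 (base C).

Lemma base_frameP : hdg_frame 0 base_frame.
Proof.
split; rewrite trmx_delta.
  by rewrite mul_delta_mx; apply/matrixP=> a b; rewrite !ord1 !mxE.
rewrite mul_delta_mx; apply/matrixP=> a b; rewrite !mxE (hdg_eq0 CI).
case: (eqVneq a (base C)) => [->|_]; last by rewrite mul0rn.
by rewrite eq_sym; case: eqP.
Qed.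

Lemma frame_entry q1 q2 (f : 'I_q1 -> 'I_N) (g : 'I_q2 -> 'I_N) (M : 'M[R]_N) :
  (\matrix_(a, b) (f a == b)%:R *m M *m (\matrix_(a, b) (g a == b)%:R)^T)
    = \matrix_(a, b) M (f a) (g b).
Proof.
apply/matrixP=> a b; rewrite !mxE (bigD1 (g b)) //= big1 => [|c nc].
  rewrite !mxE eqxx mulr1 addr0 (bigD1 (f a)) //= big1 => [|c nc].
    by rewrite !mxE eqxx mul1r addr0.
  by rewrite mxE eq_sym (negPf nc) mul0r.
by rewrite !mxE eq_sym (negPf nc) mulr0.
Qed.

Definition free_of : free_complex K n := FreeComplex
  (fun i (a : 'I_#|layer i|) => mdeg (mdg (enum_val a)))
  (\col_a poly_dif (enum_val a) (base C))
  (fun i => \matrix_(a, b) poly_dif (enum_val a) (enum_val b)).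

Lemma aug_free_of : aug free_of = layer_frame 0 *m poly_dif *m base_frame^T.
Proof.
have -> : base_frame = \matrix_(a < 1, b < N) (base C == b)%:R.
  by apply/matrixP=> a b; rewrite !mxE ord1 eqxx /= eq_sym.
by rewrite frame_entry; apply/matrixP=> a b; rewrite !mxE.
Qed.

Lemma diff_free_of i :
  diff free_of i = layer_frame i.+1 *m poly_dif *m (layer_frame i)^T.
Proof. by rewrite frame_entry. Qed.

Lemma graded_entry_poly_dif a b :
  graded_entry (mdeg (mdg a)) (mdeg (mdg b)) (poly_dif a b).
Proof.
move=> m; rewrite mxE.
have [->|nz] := eqVneq (dif C a b) 0; first by rewrite scale0r msupp0.
rewrite msuppMCX // inE => /eqP->.
by rewrite -mdegD submK // (dif_mdg CI).
Qed.

Lemma free_of_resolution (J : R -> Prop) :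
    (forall p, J p <-> forall m, m \in msupp p -> I m) ->
  minimal_graded_resolution free_of J.
Proof.
move=> JI; split.
- split=> [a|i a b]; rewrite mxE; last exact: graded_entry_poly_dif.
  have := @graded_entry_poly_dif (enum_val a) (base C).
  by rewrite (mdg_base CI) mdeg0.
- split=> [p|u|i u].
  + apply: (iff_trans (JI p)); apply: (iff_trans (iff_sym (poly_dif_base p))).
    have [AA Ap] := layer_frameP 0; have [BB Bp] := base_frameP.
    split=> [[V hV]|[u <-]].
      exists (V *m (layer_frame 0)^T); rewrite aug_free_of !mulmxA.
      rewrite -(mulmxA V) Ap -(mulmxA V) -poly_dif_proj -Bp !mulmxA hV.
      rewrite -(mulmxA _ base_frame) BB mulmx1 -scalemxAl trmx_delta.
      by rewrite mul_delta_mx !mxE !eqxx mulr1.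
    exists (u *m layer_frame 0); rewrite aug_free_of.
    have projA : layer_frame 0 *m hdg_proj 1 = layer_frame 0.
      by rewrite -Ap mulmxA AA mul1mx.
    rewrite -[in LHS]projA -!mulmxA -poly_dif_proj -Bp !mulmxA.
    by rewrite [in LHS](mx11_scalar (_ *m _^T)) mul_scalar_mx.
  + rewrite aug_free_of diff_free_of.
    exact: (poly_dif_frame _ (layer_frameP 1) (layer_frameP 0) base_frameP).
  + rewrite !diff_free_of.
    exact: (poly_dif_frame _ (layer_frameP i.+2) (layer_frameP _)
      (layer_frameP _)).
- move=> i a b; rewrite !mxE mcoeffZ mcoeffX.
  set a' := enum_val a; set b' := enum_val b.
  have [->|nz] := eqVneq (dif C a' b') 0; first by rewrite mul0r.
  (* A nonzero constant entry would join two basis vectors of equal multidegree. *)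
  case: eqP => [d0|_]; last by rewrite mulr0.
  have := dif_min CI nz; rewrite -(submK (dif_mdg CI nz)) d0.
  by rewrite add0m eqxx.
Qed.

End FreeComplex.

(** Dropping the base vector lowers homological degrees by one, so the regularity rises by one. As
    [rho] is positive, it is not attained at the base vector, whose degree is 0. *)
Lemma regularity_has_regularity (K : fieldType) (n : nat)
    (I : 'X_{1..n} -> Prop) (V : pred 'I_n) (rho : nat)
    (J : {mpoly K[n]} -> Prop) :
    regularity K I V rho -> (0 < rho)%N ->
    (forall p, J p <-> forall m, m \in msupp p -> I m) ->
  has_regularity J (Posz (rho + 1)).
Proof.
move=> [C [CI _ le_C [a0 eq_a0]]] rho_gt0 JI.
pose F := free_of C.
exists (fun i j => #|[set a : 'I_(rk F i) | gdeg a == j]|); split.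
- by exists F; split=> //; apply: (free_of_resolution CI).
- have hdg_gt0 : (0 < hdg a0)%N.
    rewrite lt0n (hdg_eq0 CI); apply/negP => /eqP a0b.
    by have := eq_a0; rewrite a0b (mdg_base CI) mdeg0; lia.
  have la0 : a0 \in layer C (hdg a0).-1 by rewrite inE prednK.
  exists (hdg a0).-1, (mdeg (mdg a0)); split; last by rewrite eq_a0; lia.
  apply/eqP; rewrite -lt0n; apply/card_gt0P; exists (enum_rank_in la0 a0).
  by rewrite inE /= enum_rankK_in.
- move=> i j /eqP; rewrite -lt0n => /card_gt0P[a]; rewrite inE => /eqP <- /=.
  have := enum_valP a; rewrite inE => /eqP hdg_a.
  by have := le_C (enum_val a); rewrite hdg_a; lia.
Qed.

(** * Associated primes and weights *)

Section VariablePrimes.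
Variables (K : fieldType) (n : nat) (C : pred 'I_n).
Local Notation R := {mpoly K[n]}.
Implicit Types (m : 'X_{1..n}) (p : R).

Definition hits m : bool := [exists i, C i && (0 < m i)%N].

Definition variable_ideal p : Prop := forall m, m \in msupp p -> hits m.

Definition kill_variables p : R :=
  p \mPo [tuple if C i then 0 else 'X_i | i < n].

Lemma kill_variablesX m :
  kill_variables 'X_[m] = if hits m then 0 else 'X_[m].
Proof.
rewrite /kill_variables comp_mpolyX; case: ifP => [/existsP[i /andP[Ci mi]]|].
  by rewrite (bigD1 i) //= tnth_mktuple Ci expr0n eqn0Ngt mi mul0r.
move=> /negbT/existsPn nohit; rewrite [RHS]mpolyXE_id; apply: eq_bigr => i _.
rewrite tnth_mktuple; case: ifP => // Ci.
by have := nohit i; rewrite Ci /= -eqn0Ngt => /eqP->; rewrite !expr0.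
Qed.

Lemma mcoeff_kill_variables p m :
  (kill_variables p)@_m = if hits m then 0 else p@_m.
Proof.
rewrite [p in kill_variables p]mpolyE /kill_variables.
rewrite (raddf_sum (comp_mpoly _)) raddf_sum /=.
have -> : (if hits m then 0 else p@_m) =
    \sum_(k <- msupp p) (p@_k *: (if hits m then 0 else 'X_[k]))@_m.
  case: ifP => hm; first by rewrite big1 // => k _; rewrite scaler0 mcoeff0.
  by rewrite [p in LHS]mpolyE raddf_sum.
apply: eq_bigr => k _; rewrite comp_mpolyZ -/(kill_variables _) kill_variablesX.
rewrite !mcoeffZ; congr (_ * _).
have [->//|nkm] := eqVneq k m.
by case: (hits k); case: (hits m); rewrite ?mcoeff0 // mcoeffX (negPf nkm).
Qed.

Lemma variable_idealE p : variable_ideal p <-> kill_variables p = 0.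
Proof.
split=> [hp|p0 m].
  apply/mpolyP=> m; rewrite mcoeff_kill_variables mcoeff0.
  case: ifP => // hm; apply/eqP; rewrite mcoeff_eq0.
  by apply/negP => /hp; rewrite hm.
rewrite mcoeff_msupp => /eqP pm; case: (boolP (hits m)) => // hm; case: pm.
have := mcoeff_kill_variables p m.
by rewrite p0 mcoeff0 (negPf hm).
Qed.

(** The ideal is the kernel of [kill_variables], a ring morphism into a domain. *)
Lemma variable_ideal_prime : is_prime variable_ideal.
Proof.
have killD p q : kill_variables (p + q) = kill_variables p + kill_variables q.
  exact: comp_mpolyD.
have killM p q : kill_variables (p * q) = kill_variables p * kill_variables q.
  exact: rmorphM.
split; first split.
- by apply/variable_idealE; apply: comp_mpoly0.
- move=> p q /variable_idealE p0 /variable_idealE q0; apply/variable_idealE.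
  by rewrite killD p0 q0 addr0.
- move=> p q /variable_idealE q0; apply/variable_idealE.
  by rewrite killM q0 mulr0.
- move/variable_idealE; rewrite /kill_variables comp_mpoly1 => /eqP.
  by rewrite oner_eq0.
- move=> p q /variable_idealE/eqP; rewrite killM mulf_eq0.
  by case/orP=> /eqP ?; [left|right]; apply/variable_idealE.
Qed.

End VariablePrimes.

(** A chain of length [h] ending at [P], extended by [Q], would exceed the common height. *)
Lemma unmixed_antichain (R : comNzRingType) (I P Q : R -> Prop) :
  unmixed_ideal I -> associated_prime I P -> associated_prime I Q ->
  ~ ideal_lt P Q.
Proof.
move=> [h hh] IP IQ PQ; have [[c [cp clt ch]] _] := hh _ IP.
have [_ /(_ h.+1 (fun k => if (k <= h)%N then c k else Q))] := hh _ IQ.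
move=> hQ; suff : (h.+1 <= h)%N by rewrite ltnn.
apply: hQ; split=> [i _|i|g]; last by rewrite ltnn.
  by case: ifP => [/cp//|_]; case: IQ.
rewrite ltnS => le_ih; rewrite le_ih; case: ltnP => [/clt//|le_hi].
have -> : i = h by apply/eqP; rewrite eqn_leq le_ih.
case: PQ => PQ [g [Qg nPg]]; split=> [f /ch/PQ//|].
by exists g; split=> // /ch.
Qed.

(** * Monomials and associated primes of the edge ideal *)

Section EdgeIdeal.
Variables (K : fieldType) (V : finType) (D : woGraph V).
Implicit Types (u v : V) (m : 'X_{1..#|V|}).

Definition edge_monomial m : Prop := exists u v,
  [/\ Defs.arc D u v, (0 < m (enum_rank u))%N
    & (weight D v <= m (enum_rank v))%N].

Lemma arc_neq u v : Defs.arc D u v -> u != v.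
Proof.
by apply: contraTneq => ->; apply/negP => h; have := arc_asym h; rewrite h.
Qed.

Lemma edge_ideal_monomials (p : {mpoly K[#|V|]}) :
  edge_ideal D K p <-> (forall m, m \in msupp p -> edge_monomial m).
Proof.
have genE (e : V * V) : vertex_var K e.1 * vertex_var K e.2 ^+ weight D e.2 =
    'X_[U_(enum_rank e.1) + U_(enum_rank e.2) *+ weight D e.2].
  by rewrite /vertex_var mpolyXn mpolyXD.
have gen_le (e : V * V) m : Defs.arc D e.1 e.2 ->
    (U_(enum_rank e.1) + U_(enum_rank e.2) *+ weight D e.2 <= m)%MM =
    (0 < m (enum_rank e.1))%N && (weight D e.2 <= m (enum_rank e.2))%N.
  by move=> /arc_neq e12; rewrite addm_mulm1_le // (inj_eq enum_rank_inj).
split=> [[c ->] m|mP].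
  rewrite mcoeff_msupp raddf_sum => nz.
  have [e /andP[ae]] : exists e : V * V, Defs.arc D e.1 e.2 &&
      ((c e * (vertex_var K e.1 * vertex_var K e.2 ^+ weight D e.2))@_m != 0).
    apply/existsP; apply: contraNT nz => /existsPn h; rewrite big1 // => e ae.
    by have := h e; rewrite ae /= negbK => /eqP.
  rewrite genE mcoeffMX_le gen_le //; case: ifP; last by rewrite eqxx.
  by move=> /andP[h1 h2] _; exists e.1, e.2.
have idealD q1 q2 : edge_ideal D K q1 -> edge_ideal D K q2 ->
    edge_ideal D K (q1 + q2).
  move=> [c1 ->] [c2 ->]; exists (fun e => c1 e + c2 e).
  by rewrite -big_split; apply: eq_bigr => e _; rewrite mulrDl.
have ideal0 : edge_ideal D K 0.
  by exists (fun=> 0); rewrite big1 // => e _; rewrite mul0r.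
rewrite [p]mpolyE big_seq; elim/big_ind: _ => // m /mP[u [v [uv mu mv]]].
exists (fun e => if e == (u, v) then
  p@_m *: 'X_[m - (U_(enum_rank u) + U_(enum_rank v) *+ weight D v)] else 0).
rewrite (bigD1 (u, v)) //= eqxx big1 => [|e /andP[_ /negPf->]]; last first.
  by rewrite mul0r.
have := genE (u, v); rewrite /= => ->.
rewrite addr0 -scalerAl -mpolyXD submK //.
by have := gen_le (u, v) m uv; rewrite /= => ->; rewrite mu.
Qed.

(* The colon by X^g is generated by the variables in C, if each of them
   completes g to a monomial of the ideal, and g stays outside the ideal even
   when the exponents outside C become infinite. *)
Lemma variable_ideal_associated (C : pred V) (g : V -> nat) :
    (forall u v, Defs.arc D u v -> (C u ==> (0 < g u))%N ->
      (C v ==> (weight D v <= g v))%N -> False) ->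
    (forall c, C c -> exists u v,
      [/\ Defs.arc D u v, (0 < g u + (u == c))%N
        & (weight D v <= g v + (v == c))%N]) ->
  associated_prime (edge_ideal D K)
    (variable_ideal (K := K) (fun i : 'I_#|V| => C (enum_val i))).
Proof.
move=> gout gin; split; first exact: variable_ideal_prime.
pose g' : 'X_{1..#|V|} := [multinom g (enum_val i) | i < #|V|].
have g'E v : g' (enum_rank v) = g v by rewrite mnmE enum_rankK.
exists 'X_[g'] => p; apply: iff_sym.
apply: (iff_trans (edge_ideal_monomials _)).
split=> hp m.
  move=> mp; have := hp (g' + m)%MM.
  rewrite (perm_mem (msuppMX _ _)) map_f ?mp // => /(_ isT)[u [v [uv]]].
  rewrite !mnmDE !g'E => mu mv.
  case: (boolP (hits _ _)) => // /existsPn nohit; exfalso.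
  have m0 c : C c -> m (enum_rank c) = 0%N.
    move=> Cc; have := nohit (enum_rank c).
    by rewrite enum_rankK Cc /= -eqn0Ngt => /eqP.
  apply: (gout u v uv); apply/implyP => /m0 h0.
    by rewrite h0 addn0 in mu.
  by rewrite h0 addn0 in mv.
rewrite (perm_mem (msuppMX _ _)) => /mapP[k /hp/existsP[i /andP[Ci ki]] ->].
have [u [v [uv gu gv]]] := gin _ Ci.
have le_add c : (g c + (c == enum_val i) <= (g' + k)%MM (enum_rank c))%N.
  rewrite mnmDE g'E leq_add2l.
  by case: eqP => // ->; rewrite enum_valK.
exists u, v; split=> //; first exact: leq_trans gu (le_add _).
exact: leq_trans gv (le_add _).
Qed.

End EdgeIdeal.

(** Otherwise each vertex of [S] has two neighbours in [S], and a path in [S] can be prolonged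
    without repetition beyond the number of vertices. *)
Lemma acyclic_leaf (T : finType) (e : rel T) : ssrbool.symmetric e ->
    irreflexive e -> (forall c : seq T, (2 < size c)%N -> ~ ucycle e c) ->
  forall S : {set T}, S != set0 -> exists2 i, i \in S &
    {in S &, forall j k, e i j -> e i k -> j = k}.
Proof.
move=> e_sym e_irr acyc S /set0Pn[s0 s0S].
case: (pickP [pred i in S | [forall j in S, forall k in S,
    e i j ==> e i k ==> (j == k)]]) => [i|noleaf].
  move=> /andP[iS /forall_inP leaf_i]; exists i => // j k jS kS eij eik.
  have /forall_inP/(_ k kS) := leaf_i j jS.
  by rewrite eij eik => /eqP.
have other i v : i \in S -> exists z, [/\ z \in S, e i z & z != v].
  move=> iS; have := noleaf i; rewrite /= iS /= => /negbT.
  rewrite negb_forall => /existsP[j]; rewrite negb_imply => /andP[jS].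
  rewrite negb_forall => /existsP[k]; rewrite negb_imply => /andP[kS].
  rewrite !negb_imply => /and3P[eij eik njk].
  have [ejv|njv] := eqVneq j v; last by exists j.
  by exists k; split=> //; rewrite -ejv eq_sym.
have long N : exists u p, [/\ uniq (u :: p), path e u p, u \in S & size p = N].
  elim: N => [|N [u [p [up ep uS sp]]]]; first by exists s0, [::].
  (* The path grows at [u] by a neighbour other than the preceding vertex [head u p]; for empty [p]
     the default [u] excludes nothing, by irreflexivity. *)
  have [z [zS euz nz]] := other u (head u p) uS.
  exists z, (u :: p); rewrite /= sp; split=> //; last by rewrite e_sym euz.
  have -> : (u \notin p) && uniq p by exact: up.
  rewrite andbT inE negb_or.
  apply/andP; split; first by apply: contraTneq euz => ->; rewrite e_irr.
  (* A repeated vertex [z] is not the one preceding [u], so it closes a cycle of length at least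
     3. *)
  apply/negP => zp; case/splitPr: zp up ep nz => p1 p2.
  case: p1 => [|v p1]; first by rewrite /= eqxx.
  rewrite -cat_cons -!cat_rcons cat_uniq cat_path => /andP[up _] /andP[ep _] _.
  apply: (acyc (u :: rcons (v :: p1) z)); first by rewrite /= size_rcons.
  apply/andP; split; last exact: up.
  by rewrite /cycle rcons_path ep last_rcons e_sym.
have [u [p [up _ _ sp]]] := long #|T|.
by have := max_card (mem (u :: p)); rewrite (card_uniqP up) /= sp ltnn.
Qed.

(** * Forests with a perfect matching by pendant sinks *)

Section Matching.
Variables (K : fieldType) (V : finType) (D : woGraph V).
Variables (r : nat) (x y : 'I_r -> V).
Hypotheses (matching : perfect_matching D x y)
  (deg_y : forall i, degree D (y i) = 1%N) (sink_y : forall i, is_sink D (y i)).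

Lemma edge_sym : ssrbool.symmetric (edge D).
Proof. by move=> u v; rewrite /edge orbC. Qed.

Lemma edge_irr : irreflexive (edge D).
Proof.
move=> u; rewrite /edge orbb; apply/negP => h.
by have := arc_neq h; rewrite eqxx.
Qed.

Lemma matching_uniq v i j :
  v \in [set x i; y i] -> v \in [set x j; y j] -> i = j.
Proof. by case: matching => _ /(_ v)[k [_ kP]] /kP <- /kP. Qed.

Lemma x_inj : injective x.
Proof.
by move=> i j eqx; apply: (@matching_uniq (x i)); rewrite ?eqx !inE eqxx.
Qed.

Lemma y_inj : injective y.
Proof.
by move=> i j eqy; apply: (@matching_uniq (y i)); rewrite ?eqy !inE eqxx orbT.
Qed.

Lemma x_neq_y i j : x i != y j.
Proof.
apply/eqP => exy; have eij : i = j.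
  by apply: (@matching_uniq (x i)); rewrite !inE ?exy eqxx ?orbT.
by have := matching.1 j; rewrite -{1}eij exy edge_irr.
Qed.

Lemma matching_cover v : (exists i, v = x i) \/ (exists i, v = y i).
Proof.
case: matching => _ /(_ v)[i [+ _]]; rewrite !inE.
by case/orP=> /eqP ->; [left|right]; exists i.
Qed.

Lemma arc_xy i : Defs.arc D (x i) (y i).
Proof.
by have := matching.1 i; rewrite /edge (negPf (sink_y i (x i))) orbF.
Qed.

Lemma edge_y i v : edge D v (y i) -> v = x i.
Proof.
move=> evy; have /eqP/cards1P[z zP] := deg_y i.
have /setP/(_ v) := zP; rewrite !inE edge_sym evy => /esym/eqP ->.
have /setP/(_ (x i)) := zP; rewrite !inE edge_sym (matching.1 i).
by move=> /esym/eqP ->.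
Qed.

Lemma arc_y i v : Defs.arc D v (y i) -> v = x i.
Proof. by move=> h; apply: edge_y; rewrite /edge h. Qed.

Lemma arc_source_x u v : Defs.arc D u v -> exists i, u = x i.
Proof.
by case: (matching_cover u) => [//|[i ->]]; rewrite (negPf (sink_y i v)).
Qed.

(* If x_i has weight at least 2 and an incoming arc from x_j, then the minimal
   vertex cover {y_j} + {x_k : k <> j} and its union with y_i both give
   associated primes. *)
Lemma unmixed_weight_x (i : 'I_r) :
  unmixed_ideal (edge_ideal D K) -> weight D (x i) = 1%N.
Proof.
move=> unmixed.
case: (pickP (fun z => Defs.arc D z (x i))) => [z|noz]; last first.
  by apply: weight_source => z; rewrite noz.
move=> azx; have [j ez] := arc_source_x azx; rewrite {z}ez in azx.
apply/eqP; rewrite eqn_leq weight_gt0 andbT leqNgt; apply/negP => w2.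
have nij : i != j by apply: contraTneq azx => ->; have := edge_irr (x j);
  rewrite /edge orbb => ->.
(* [M] plays the part of an infinite exponent. *)
pose M := (\max_v weight D v)%N.
have wM v : (weight D v <= M)%N by apply: leq_bigmax.
have M0 : (0 < M)%N by apply: leq_trans (weight_gt0 D (x i)) (wM _).
pose C0 v := (v == y j) || [exists k, (k != j) && (v == x k)].
pose C1 v := C0 v || (v == y i).
(* Exponents are [M] off the cover. On it they are one less than the weight at vertices completed by
   an arc pointing to them ([y j], and for [g1] also [y i] and [x i]), and 0 at those completed as
   the tail of their matching arc. *)
pose g0 v := if v == y j then (weight D v).-1 else if C0 v then 0%N else M.
pose g1 v := if [|| v == y j, v == y i | v == x i] then (weight D v).-1
  else if C0 v then 0%N else M.
have yx a b : (y a == x b) = false by rewrite eq_sym (negPf (x_neq_y _ _)).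
have xy a b : (x a == y b) = false by rewrite (negPf (x_neq_y _ _)).
have xx a b : (x a == x b) = (a == b) by rewrite (inj_eq x_inj).
have yy a b : (y a == y b) = (a == b) by rewrite (inj_eq y_inj).
have C0x k : C0 (x k) = (k != j).
  rewrite /C0 xy /=; apply/existsP/idP => [[l /andP[lj]]|kj].
    by rewrite xx => /eqP->.
  by exists k; rewrite kj eqxx.
have C0y k : C0 (y k) = (k == j).
  rewrite /C0 yy; case: eqP => //= _; apply/existsP => -[l].
  by rewrite yx andbF.
have C1x k : C1 (x k) = (k != j) by rewrite /C1 C0x xy orbF.
have C1y k : C1 (y k) = (k == j) || (k == i) by rewrite /C1 C0y yy.
have g0x k : g0 (x k) = if k == j then M else 0%N.
  by rewrite /g0 xy C0x; case: eqP.
have g0y k : g0 (y k) = if k == j then (weight D (y k)).-1 else M.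
  by rewrite /g0 yy C0y; case: eqP.
have g1x k : g1 (x k) = if k == i then (weight D (x k)).-1
    else if k == j then M else 0%N.
  by rewrite /g1 !xy xx C0x; case: eqP => //= _; case: eqP.
have g1y k : g1 (y k) = if (k == j) || (k == i) then (weight D (y k)).-1 else M.
  by rewrite /g1 yx !yy orbF C0y; case: eqP.
have wpos v : (weight D v <= (weight D v).-1)%N = false.
  by have := weight_gt0 D v; lia.
have wpred v : (weight D v <= (weight D v).-1 + 1)%N.
  by have := weight_gt0 D v; lia.
have w0 v : (weight D v <= 0)%N = false by have := weight_gt0 D v; lia.
have noloop k : Defs.arc D (x k) (x k) = false.
  by have := edge_irr (x k); rewrite /edge orbb.
have nox_ij : Defs.arc D (x i) (x j) = false.
  by apply: negbTE; apply: arc_asym.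
have P0 : associated_prime (edge_ideal D K)
    (variable_ideal (K := K) (fun l : 'I_#|V| => C0 (enum_val l))).
  apply: (@variable_ideal_associated K V D C0 g0).
    move=> u v uv; have [k eu] := arc_source_x uv; rewrite {u}eu in uv *.
    rewrite C0x g0x; have [ekj _|//] := eqVneq k j; rewrite {k}ekj in uv.
    case: (matching_cover v) uv => -[l ->] uv.
      rewrite C0x g0x; have [elj|_] := eqVneq l j; last by rewrite /= w0.
      by rewrite elj noloop in uv.
    have /x_inj ejl := arc_y uv; rewrite -ejl.
    by rewrite C0y g0y eqxx /= wpos.
  move=> c; case: (matching_cover c) => -[k ->].
    rewrite C0x => nkj; exists (x k), (y k); split; first exact: arc_xy.
      by rewrite eqxx addn1.
    by rewrite g0y (negPf nkj) yx addn0.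
  rewrite C0y => /eqP->; exists (x j), (y j); split; first exact: arc_xy.
    by rewrite g0x eqxx xy addn0.
  by rewrite g0y !eqxx.
have P1 : associated_prime (edge_ideal D K)
    (variable_ideal (K := K) (fun l : 'I_#|V| => C1 (enum_val l))).
  apply: (@variable_ideal_associated K V D C1 g1).
    move=> u v uv; have [k eu] := arc_source_x uv; rewrite {u}eu in uv *.
    rewrite C1x g1x => hk.
    have {hk} kij : k = i \/ k = j.
      move: hk; have [->|_] := eqVneq k i; first by left.
      by have [->|_] := eqVneq k j; first by right.
    case: (matching_cover v) uv => -[l ->] uv.
      rewrite C1x g1x; have [eli|nli] := eqVneq l i.
        by rewrite eli nij /= wpos.
      have [elj|nlj] := eqVneq l j; last by rewrite /= w0.
      by rewrite elj in uv; case: kij => ek; rewrite ek ?noloop ?nox_ij in uv.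
    have /x_inj ekl := arc_y uv; rewrite -ekl C1y g1y.
    have -> : (k == j) || (k == i) by case: kij => ->; rewrite eqxx ?orbT.
    by rewrite /= wpos.
  move=> c; case: (matching_cover c) => -[k ->].
    rewrite C1x => nkj; have [->|nki] := eqVneq k i.
      exists (x j), (x i); split=> //.
        by rewrite g1x eq_sym (negPf nij) eqxx addn_gt0 M0.
      by rewrite g1x !eqxx.
    exists (x k), (y k); split; first exact: arc_xy.
      by rewrite eqxx addn1.
    by rewrite g1y (negPf nkj) (negPf nki) yx addn0.
  rewrite C1y => /orP[/eqP->|/eqP->].
    exists (x j), (y j); split; first exact: arc_xy.
      by rewrite g1x eq_sym (negPf nij) eqxx addn_gt0 M0.
    by rewrite g1y !eqxx.
  (* Weight at least 2 enters here: the exponent of [x i], its weight minus one, is positive, so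
     [y i] completes the generator of its matching arc. *)
  exists (x i), (y i); split; first exact: arc_xy.
    by rewrite g1x eqxx addn_gt0 -subn1 subn_gt0 w2.
  by rewrite g1y !eqxx orbT.
apply: (unmixed_antichain unmixed P0 P1); split.
  move=> p hp m /hp/existsP[l /andP[Cl ml]]; apply/existsP; exists l.
  by rewrite /C1 Cl ml.
exists 'X_(enum_rank (y i)); split.
  move=> m; rewrite msuppX inE => /eqP->; apply/existsP.
  by exists (enum_rank (y i)); rewrite enum_rankK C1y mnm1E !eqxx orbT.
move=> /(_ U_(enum_rank (y i))%MM); rewrite msuppX inE eqxx => /(_ isT).
case/existsP=> l /andP[Cl]; rewrite mnm1E; case: eqVneq => // el _.
by move: Cl; rewrite -el enum_rankK C0y (negPf nij).
Qed.

(** Each [y i] is a leaf attached to [x i], so an edge joining two distinct matching edges must join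
    their [x] ends. *)
Lemma nonadjacent_independent (A : {set 'I_r}) :
  nonadjacent_family D x y A = independent (fun i j => edge D (x i) (x j)) A.
Proof.
apply/forall_inP/independentP => hA i => [j|] iA.
  move=> jA; have [->|nij] := eqVneq i j; first by rewrite edge_irr.
  have /forall_inP/(_ j jA) := hA i iA; rewrite nij /=; apply: contra => eij.
  apply/existsP; exists (x i); rewrite !inE eqxx /=.
  by apply/existsP; exists (x j); rewrite !inE eqxx.
apply/forall_inP=> j jA; apply/implyP => nij; apply: contra (hA i j iA jA).
case/existsP=> a /andP[ai /existsP[b /andP[bj eab]]].
move: ai bj eab; rewrite !inE => /orP[/eqP->|/eqP->] /orP[/eqP->|/eqP->] //.
- by move/edge_y/x_inj => eij; rewrite eij eqxx in nij.
- by rewrite edge_sym => /edge_y/x_inj eij; rewrite eij eqxx in nij.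
- by move/edge_y/eqP; rewrite eq_sym (negPf (x_neq_y _ _)).
Qed.

(** Since every [x i] has weight 1, an arc between [x i] and [x j] contributes the product of the
    two variables in either direction; all other arcs go from [x i] to [y i]. *)
Lemma edge_monomial_whisker (m : 'X_{1..#|V|}) :
    (forall i, weight D (x i) = 1%N) ->
  whisker (fun i => enum_rank (x i)) (fun i => enum_rank (y i))
    (fun i => weight D (y i)) (fun i j => edge D (x i) (x j)) setT m
  <-> edge_monomial D m.
Proof.
move=> wx; split=> [[i [_ mi []]]|[u [v [uv mu mv]]]].
- by move=> my; exists (x i), (y i); split=> //; apply: arc_xy.
- case=> j [_ /orP[] axx mj]; last by exists (x j), (x i); rewrite wx.
  by exists (x i), (x j); rewrite wx.
have [i eu] := arc_source_x uv; rewrite {u}eu in uv mu.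
case: (matching_cover v) uv mv => -[j ->] uv mv; exists i; split=> //.
  by right; exists j; split=> //; [rewrite /edge uv|rewrite wx in mv].
by left; have /x_inj-> := arc_y uv.
Qed.

End Matching.

Theorem theorem3p6 (K : fieldType) (V : finType) (D : woGraph V)
    (r : nat) (x y : 'I_r -> V)
    (hforest : is_forest D)
    (hunmixed : unmixed_ideal (edge_ideal D K))
    (hr : (0 < r)%N)
    (hmatching : perfect_matching D x y)
    (hdeg : forall i, degree D (y i) = 1%N)
    (hsink : forall i, is_sink D (y i)) :
  has_regularity (edge_ideal D K)
    (Posz (\max_(A : {set 'I_r} | (A != set0) && nonadjacent_family D x y A)
             ((\sum_(j in A) weight D (y j)) + 1))%N).
Proof.
pose e i j := edge D (x i) (x j); pose w i := weight D (y i).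
have e_sym : ssrbool.symmetric e by move=> i j; apply: edge_sym.
have e_irr : irreflexive e by move=> i; apply: edge_irr.
have xI := x_inj hmatching; have yI := y_inj hmatching.
have wx i := unmixed_weight_x hmatching hdeg hsink i hunmixed.
have acyc (c : seq 'I_r) : (2 < size c)%N -> ~ ucycle e c.
  move=> c2 /andP[ec uc]; apply: (hforest (map x c)); rewrite ?size_map //.
  by rewrite /ucycle map_inj_uniq // uc andbT cycle_map.
have alpha_ge i : (w i <= alpha e w setT)%N.
  have := @independent_le _ e w [set i] setT (subsetT _).
  rewrite big_set1; apply; apply/independentP => a b /set1P-> /set1P->.
  by rewrite e_irr.
have alpha_gt0 : (0 < alpha e w setT)%N.
  exact: leq_trans (weight_gt0 D _) (alpha_ge (Ordinal hr)).
(* The maximum excludes the empty family while [alpha] admits it; since [alpha] is positive, an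
   optimal set is nonempty. *)
have -> : (\max_(A : {set 'I_r} | (A != set0) && nonadjacent_family D x y A)
    ((\sum_(j in A) weight D (y j)) + 1))%N = (alpha e w setT + 1)%N.
  apply/eqP; rewrite eqn_leq; apply/andP; split.
    apply/bigmax_leqP => A /andP[_]; rewrite nonadjacent_independent // => iA.
    by rewrite leq_add2r; apply: independent_le; rewrite ?subsetT.
  have [A [_ iA alphaA]] := alpha_attained e w setT.
  rewrite alphaA; apply: (leq_bigmax_cond (P := fun A : {set 'I_r} => _)
    (F := fun A : {set 'I_r} => (\sum_(j in A) weight D (y j) + 1)%N)).
  rewrite nonadjacent_independent // iA andbT.
  by apply: contraTneq alpha_gt0; rewrite alphaA => ->; rewrite big_set0.
pose X i := enum_rank (x i); pose Y i := enum_rank (y i).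
have reg : regularity K (whisker X Y w e setT) (whisker_vars X Y setT)
    (alpha e w setT).
  apply: regularity_whisker => //.
  - exact: inj_comp enum_rank_inj xI.
  - exact: inj_comp enum_rank_inj yI.
  - by move=> i j; rewrite (inj_eq enum_rank_inj); apply: (x_neq_y hmatching).
  - by move=> i; apply: weight_gt0.
  - exact: acyclic_leaf.
apply: (regularity_has_regularity reg alpha_gt0) => p.
apply: iff_trans (edge_ideal_monomials _ _) _.
by split=> h m /h; apply edge_monomial_whisker.
Qed.
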